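(* If $V$ is a DVR of equicharacteristic $0$ that has infinite transcendence degree over its prime subfield, then for each integer $d>1$, $V$ is the normalization of a bad Noetherian stable domain of embedding dimension $d$.
   Context: A DVR is a rank one discrete valuation ring; equicharacteristic $0$ means that $V$ and its residue field both have characteristic $0$. The normalization of a domain is its integral closure in its quotient field. An ideal $I$ of a ring $R$ is stable if $I$ is projective over its ring of endomorphisms; $R$ is a stable ring if every ideal of $R$ containing a nonzerodivisor is stable. A bad stable ring (or domain) is a one-dimensional quasilocal (i.e. having a unique maximal ideal) stable domain whose normalization is not a finitely generated module over it; a bad Noetherian stable domain is a bad stable ring that is Noetherian. Embedding dimension is the minimal number of generators of the maximal ideal. *)

(* Defs.v *)
From HB Require Import structures.
From mathcomp Require Import all_boot all_order all_algebra.
From mathcomp Require Import boolp.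
From mathcomp.multinomials Require Import mpoly.

Set Implicit Arguments.
Unset Strict Implicit.
Unset Printing Implicit Defensive.

Import Order.TTheory GRing.Theory Num.Theory.
Local Open Scope ring_scope.

(* The product of [endo U] is composition, so that U is a left module over
   [endo U], acting by evaluation. *)
Definition endo (R : comNzRingType) (U : lmodType R) := {linear U -> U}.

Section EndoRing.
Variables (R : comNzRingType) (U : lmodType R).
Implicit Types f g h : endo U.

HB.instance Definition _ := gen_eqMixin (endo U).
HB.instance Definition _ := gen_choiceMixin (endo U).

Lemma endo_ext f g : (forall x, f x = g x) -> f = g.
Proof.
case: f g => [f [[[f1 f2]] [fZ]]] [g [[[g1 g2]] [gZ]]] /= /funext efg.
subst g; by congr GRing.Linear.Pack; congr GRing.Linear.Class;
  congr GRing.isNmodMorphism.Axioms_ || congr GRing.isScalable.Axioms_;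
  rewrite ?(Prop_irrelevance f1 g1) ?(Prop_irrelevance fZ gZ)
          ?(Prop_irrelevance f2 g2).
Qed.

Definition endo_zero : endo U := \0.
Definition endo_opp f : endo U := \- f.
Definition endo_add f g : endo U := f \+ g.
Definition endo_one : endo U := idfun.
Definition endo_mul f g : endo U := f \o g.

Lemma endo_addA : associative endo_add.
Proof. by move=> f g h; apply: endo_ext => x /=; rewrite addrA. Qed.
Lemma endo_addC : commutative endo_add.
Proof. by move=> f g; apply: endo_ext => x /=; rewrite addrC. Qed.
Lemma endo_add0 : left_id endo_zero endo_add.
Proof. by move=> f; apply: endo_ext => x /=; rewrite add0r. Qed.
Lemma endo_addN : left_inverse endo_zero endo_opp endo_add.
Proof. by move=> f; apply: endo_ext => x /=; rewrite addNr. Qed.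
Lemma endo_mulA : associative endo_mul.
Proof. by move=> f g h; apply: endo_ext. Qed.
Lemma endo_mul1 : left_id endo_one endo_mul.
Proof. by move=> f; apply: endo_ext. Qed.
Lemma endo_mulr1 : right_id endo_one endo_mul.
Proof. by move=> f; apply: endo_ext. Qed.
Lemma endo_mulDl : left_distributive endo_mul endo_add.
Proof. by move=> f g h; apply: endo_ext. Qed.
Lemma endo_mulDr : right_distributive endo_mul endo_add.
Proof. by move=> f g h; apply: endo_ext => x /=; rewrite raddfD. Qed.

HB.instance Definition _ := GRing.isZmodule.Build (endo U)
  endo_addA endo_addC endo_add0 endo_addN.
HB.instance Definition _ := GRing.Zmodule_isPzRing.Build (endo U)
  endo_mulA endo_mul1 endo_mulr1 endo_mulDl endo_mulDr.

(* An alias of U carrying the [endo U]-module structure. *)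
Definition endo_module : Type := U.
HB.instance Definition _ := GRing.Zmodule.on endo_module.

Definition endo_scale (f : endo U) (x : endo_module) : endo_module := f x.

Lemma endo_scaleA f g x :
  endo_scale f (endo_scale g x) = endo_scale (f * g) x.
Proof. by []. Qed.
Lemma endo_scale1 : left_id 1 endo_scale.
Proof. by []. Qed.
Lemma endo_scaleDr : right_distributive endo_scale +%R.
Proof. by move=> f x y; rewrite /endo_scale (raddfD f). Qed.
Lemma endo_scaleDl x : {morph endo_scale^~ x : f g / f + g}.
Proof. by []. Qed.

HB.instance Definition _ := GRing.Zmodule_isLmodule.Build (endo U) endo_module
  endo_scaleA endo_scale1 endo_scaleDr endo_scaleDl.

End EndoRing.

Definition projective (E : pzRingType) (P : lmodType E) : Prop :=
  forall (A B : lmodType E) (g : {linear A -> B}) (h : {linear P -> B}),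
    (forall b, exists a, g a = b) ->
    exists k : {linear P -> A}, forall x, g (k x) = h x.

(* Membership is boolean; under the axioms of boolp every ideal is of this
   form. *)
Notation ideal R := (submodClosed R^o).

Section IdealModule.
Variables (R : comNzRingType) (I : ideal R).

Definition ideal_module := {x : R^o | x \in I}.
HB.instance Definition _ := SubType.on ideal_module.
HB.instance Definition _ := Choice.on ideal_module.
HB.instance Definition _ := [SubChoice_isSubLmodule of ideal_module by <:].

End IdealModule.

Section Ideals.
Variable R : comNzRingType.
Implicit Types I J : ideal R.

Definition prime_ideal I : Prop :=
  1 \notin I /\ forall x y : R, x * y \in I -> x \in I \/ y \in I.

Definition maximal_ideal I : Prop :=
  1 \notin I /\ forall J, {subset I <= J} -> 1 \notin J -> J =i I.

Definition quasilocal : Prop :=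
  exists2 m, maximal_ideal m & forall m', maximal_ideal m' -> m' =i m.

Definition prime_chain (n : nat) : Prop :=
  exists P : nat -> ideal R,
    (forall i, (i <= n)%N -> prime_ideal (P i)) /\
    (forall i, (i < n)%N ->
       {subset P i <= P i.+1} /\ exists2 x, x \in P i.+1 & x \notin P i).

Definition has_krull_dim (n : nat) : Prop :=
  prime_chain n /\ ~ prime_chain n.+1.

Definition stable_ideal I : Prop :=
  @projective (endo (ideal_module I)) (endo_module (ideal_module I)).

Definition stable_ring : Prop :=
  forall I, (exists2 x : R, x \in I & GRing.lreg x) -> stable_ideal I.

End Ideals.

(* N is the R-submodule of K generated by n elements, R acting on K by phi. *)
Definition generated_by (R K : comNzRingType) (phi : {rmorphism R -> K})
    (n : nat) (N : K -> Prop) : Prop :=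
  exists g : 'I_n -> K,
    forall x, N x <-> exists c : 'I_n -> R, x = \sum_i phi (c i) * g i.

Definition ideal_generated_by (R : comNzRingType) (n : nat) (I : ideal R) :=
  generated_by (idfun : {rmorphism R -> R}) n (fun x => x \in I).

Definition noetherian (R : comNzRingType) : Prop :=
  forall I : ideal R, exists n, ideal_generated_by n I.

Definition has_embedding_dim (R : comNzRingType) (d : nat) : Prop :=
  exists2 m : ideal R, maximal_ideal m &
    ideal_generated_by d m /\ forall n, ideal_generated_by n m -> (d <= n)%N.

Definition in_normalization (R : idomainType) (x : {fraction R}) : Prop :=
  integralOver (@tofrac R) x.

(* V is the normalization of R: the integral closure of R in its quotient field
   is a copy of V. *)
Definition is_normalization (V R : idomainType) : Prop :=
  exists2 iota : {rmorphism V -> {fraction R}}, injective iota &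
    forall x, in_normalization x <-> exists v, iota v = x.

Definition bad_stable_domain (R : idomainType) : Prop :=
  [/\ has_krull_dim R 1, quasilocal R, stable_ring R &
      ~ exists n, generated_by (@tofrac R) n (@in_normalization R)].

Definition bad_noetherian_stable_domain (R : idomainType) : Prop :=
  bad_stable_domain R /\ noetherian R.

(* The value of v at 0 is irrelevant. *)
Definition discrete_valuation (F : fieldType) (v : F -> int) : Prop :=
  [/\ forall x y, x != 0 -> y != 0 -> v (x * y) = v x + v y,
      forall x y, x != 0 -> y != 0 -> x + y != 0 ->
        Num.min (v x) (v y) <= v (x + y) &
      forall n : int, exists2 x, x != 0 & v x = n].

Definition is_DVR (V : idomainType) : Prop :=
  exists2 v : {fraction V} -> int, discrete_valuation v &
    forall x : {fraction V},
      (exists a : V, x = tofrac a) <-> (x = 0 \/ 0 <= v x).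

Definition is_residue_map (V : comNzRingType) (k : fieldType)
    (pi : {rmorphism V -> k}) : Prop :=
  (forall y, exists x, pi x = y) /\
  exists2 m : ideal V, maximal_ideal m & forall x, x \in m <-> pi x = 0.

Definition equichar0 (V : comNzRingType) : Prop :=
  [pchar V] =i pred0 /\
  exists (k : fieldType) (pi : {rmorphism V -> k}),
    is_residue_map pi /\ [pchar k] =i pred0.

(* Meant for rings V in which every positive integer is invertible: the prime
   subfield is then the image of [ratr : rat -> V]. *)
Definition alg_independent (V : comUnitRingType) (n : nat)
    (x : 'I_n -> V) : Prop :=
  forall p : {mpoly rat[n]}, mmap (@ratr V) x p = 0 -> p = 0.

(* The transcendence degree is the supremum of the sizes of the algebraically
   independent families; that of V equals that of its quotient field. *)
Definition infinite_trdeg (V : comUnitRingType) : Prop :=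
  forall n, exists x : 'I_n -> V, alg_independent x.

(* Main.v *)
Require Import Defs.
From HB Require Import structures.
From mathcomp Require Import all_boot all_order all_algebra.
From mathcomp Require Import boolp classical_sets.
From mathcomp.multinomials Require Import mpoly.
From mathcomp Require Import generic_quotient ring zify.

(** Let F be the fraction field of V, let t be a uniformizer, and put n = d - 1,
    so that n > 0.  The ring R consists of the a in V such that
    D_1 a, ..., D_n a all lie in V, for suitable derivations D_1, ..., D_n of F
    with D_j t = 0.

    The derivations.  As F has characteristic 0, a derivation from a subring of F
    to F extends to all of F [deriv_graph_extension], so algebraically
    independent elements have dual derivations [dual_derivation].  Since V
    contains more than m algebraically independent elements for every m, linear
    algebra gives, for every finite subset of F, a derivation killing that subset
    but not all of V [new_derivation].  Iterating and gluing yields a sequence in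
    V on which a derivation killing t may take any prescribed values
    [free_sequence].  When poles of unbounded order are prescribed, the image of V
    under (D_1, ..., D_n) is t-adically dense in F^n [der_dense]: if t^k z lies in
    V and u in V satisfies D_j u = t^-k, then t^k z u lies in V and
    D_j (t^k z u) = z + t^k u D_j z, where the last term is small for large k.

    The ring.  By density, r |-> (r, D_1 r, ..., D_n r) embeds R in the trivial
    extension of V by V^n with t-adically dense image, and divisibility by t in R
    can be read off the image [analytically_split].  In other words, the
    completion of R is the trivial extension of the completion of V by a free
    module of rank n.  Every property of R follows from this:
    - a nonzero ideal contains a power of t [ideal_power_tau], because t^k / r
      lies in R for large k; hence R is local of dimension one;
    - R is stable.  Let x have least value in the ideal I and let y, z be in I.
      Choose r, s in R close to z / x and y / x.  The two elements y - s x and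
      z - r x of I are divisible by a high power of t in V, so their product is
      divisible by that power in R and lies in x I; hence y z lies in x I
      [split_ideal_square].  So I^2 = x I, and I is free of rank one over its
      endomorphism ring [stable_ideal_square];
    - R is Noetherian: modulo a power of t lying in I, the coordinates
      r, D_1 r, ..., D_n r of the elements of I can be cleared one at a time
      [split_noetherian];
    - the maximal ideal is generated by t and n elements that are dual to the D_j
      modulo t.  Its n + 1 coordinates r / t, D_1 r, ..., D_n r modulo t are linear
      over the residue field, so no fewer generators suffice [max_ideal_rank];
    - V is the normalization of R: if r in R is close to v in V, then
      (v - r)^2 lies in R [split_quadratic].  It is not finite over R, as no power
      of t multiplies V into R: some r in R is divisible by t^(m+1) in V while
      D_1 r is a unit [split_not_finite]. *)

Set Implicit Arguments.
Unset Strict Implicit.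
Unset Printing Implicit Defensive.

Import Order.TTheory GRing.Theory Num.Theory.
Local Open Scope ring_scope.

(** * Extending derivations *)

Section DerivationExtension.
Variable F : fieldType.
Implicit Types (G H : set (F * F)) (a b c x y z : F) (p q m : {poly F}).

Definition derivation (D : F -> F) : Prop :=
  (forall x y, D (x - y) = D x - D y) /\
  (forall x y, D (x * y) = x * D y + y * D x).

(** The graph of a derivation from a subring of F to F.  Equivalently, a subring of
    the dual numbers over F that projects injectively to F.  For graphs, the
    union of a chain is an upper bound, as Zorn's lemma needs. *)
Definition deriv_graph G : Prop :=
  [/\ G (1, 0),
      forall x a y b, G (x, a) -> G (y, b) -> G (x - y, a - b),
      forall x a y b, G (x, a) -> G (y, b) -> G (x * y, x * b + y * a) &
      forall a, G (0, a) -> a = 0].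

(** Pairs (p, q) where q is p with the derivation applied to its coefficients. *)
Definition poly_graph G p q : Prop := forall i, G (p`_i, q`_i).

(** The extension of the derivation to the subring generated by a, with value b at
    a, as dictated by the chain rule. *)
Definition adjoin_graph G a b : set (F * F) :=
  fun w => exists p q, [/\ poly_graph G p q, w.1 = p.[a] &
                           w.2 = q.[a] + p^`().[a] * b].

Section Graph.
Variable G : set (F * F).
Hypothesis hG : deriv_graph G.

Lemma deriv_graph0 : G (0, 0).
Proof. by case: hG => G1 GB _ _; have := GB _ _ _ _ G1 G1; rewrite !subrr. Qed.

Lemma deriv_graphN x a : G (x, a) -> G (- x, - a).
Proof.
by case: hG => _ GB _ _ /(GB _ _ _ _ deriv_graph0); rewrite !sub0r.
Qed.

Lemma deriv_graphD x a y b : G (x, a) -> G (y, b) -> G (x + y, a + b).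
Proof.
case: hG => _ GB _ _ Gx /deriv_graphN Gy.
by have := GB _ _ _ _ Gx Gy; rewrite !opprK.
Qed.

Lemma deriv_graph_sum (I : Type) (r : seq I) (f g : I -> F) :
  (forall i, G (f i, g i)) -> G (\sum_(i <- r) f i, \sum_(i <- r) g i).
Proof.
move=> Gfg; elim: r => [|i r IHr]; first by rewrite !big_nil; apply: deriv_graph0.
by rewrite !big_cons; apply: deriv_graphD.
Qed.

Lemma deriv_graphMn x a k : G (x, a) -> G (x *+ k, a *+ k).
Proof.
move=> Gx; elim: k => [|k IHk]; first by rewrite !mulr0n; apply: deriv_graph0.
by rewrite !mulrSr; apply: deriv_graphD.
Qed.

Lemma deriv_graph_fun x a b : G (x, a) -> G (x, b) -> a = b.
Proof.
case: hG => _ GB _ G0 Ga Gb; apply/eqP; rewrite -subr_eq0; apply/eqP/G0.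
by have := GB _ _ _ _ Ga Gb; rewrite subrr.
Qed.

Lemma poly_graphM p q p' q' : poly_graph G p q -> poly_graph G p' q' ->
  poly_graph G (p * p') (p * q' + p' * q).
Proof.
case: hG => _ _ GM _ Gp Gp' i; rewrite coefD [p' * q]mulrC !coefM -big_split /=.
apply: deriv_graph_sum => j; rewrite [q`_j * _]mulrC; exact: GM.
Qed.

Lemma poly_graphC x a : G (x, a) -> poly_graph G x%:P a%:P.
Proof. by move=> Gx i; rewrite !coefC; case: eqP => // _; apply: deriv_graph0. Qed.

Lemma poly_graphXn k : poly_graph G 'X^k 0.
Proof.
move=> i; rewrite coefXn coef0; case: eqP => _; last exact: deriv_graph0.
by case: hG.
Qed.

Lemma poly_graphB p q p' q' : poly_graph G p q -> poly_graph G p' q' ->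
  poly_graph G (p - p') (q - q').
Proof. by move=> Gp Gp' i; rewrite !coefB; case: hG => _ GB _ _; apply: GB. Qed.

Lemma sub_adjoin_graph a b w : G w -> adjoin_graph G a b w.
Proof.
case: w => x y Gz; exists x%:P, y%:P; split; first exact: poly_graphC.
  by rewrite hornerC.
by rewrite derivC !hornerC mul0r addr0.
Qed.

Lemma adjoin_graph_gen a b : adjoin_graph G a b (a, b).
Proof.
exists 'X, 0; split; first exact: (poly_graphXn 1).
  by rewrite hornerX.
by rewrite derivX !hornerC mul1r add0r.
Qed.

(** The hypothesis says that the value prescribed by the chain rule at p(a) depends
    only on p(a). *)
Lemma adjoin_deriv_graph a b :
  (forall p q, poly_graph G p q -> p.[a] = 0 -> q.[a] + p^`().[a] * b = 0) ->
  deriv_graph (adjoin_graph G a b).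
Proof.
move=> hab; split=> [|x c y d|x c y d|c].
- by apply: sub_adjoin_graph; case: hG.
- move=> [p [q [Gp /= -> ->]]] [p' [q' [Gp' /= -> ->]]].
  exists (p - p'), (q - q'); split; first exact: poly_graphB.
    by rewrite hornerD hornerN.
  by rewrite derivB !hornerD !hornerN /=; ring.
- move=> [p [q [Gp /= -> ->]]] [p' [q' [Gp' /= -> ->]]].
  exists (p * p'), (p * q' + p' * q); split; first exact: poly_graphM.
    by rewrite hornerM.
  by rewrite derivM !hornerD !hornerM /=; ring.
- by move=> [p [q [Gp /= pa ->]]]; apply: hab.
Qed.

(** The extension of the derivation to the fraction field, by the quotient rule. *)
Definition frac_graph : set (F * F) :=
  fun w => exists x a y b, [/\ G (x, a), G (y, b), y != 0, w.1 = x / y &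
                             w.2 = (a * y - x * b) / y ^+ 2].

Lemma sub_frac_graph w : G w -> frac_graph w.
Proof.
case: w => x a Gx; exists x, a, 1, 0; split => //.
- by case: hG.
- exact: oner_neq0.
- by rewrite divr1.
- by rewrite mulr1 mulr0 subr0 expr1n divr1.
Qed.

Lemma frac_deriv_graph : deriv_graph frac_graph.
Proof.
case: (hG) => G1 GB GM G0.
split=> [|x1 x2 y1 y2|x1 x2 y1 y2|c].
- exact: sub_frac_graph.
- move=> [x [a [y [b [Gx Gy y0 /= -> ->]]]]] [x' [a' [y' [b' [Gx' Gy' y'0 /= -> ->]]]]].
  exists (x * y' - y * x'), ((x * b' + y' * a) - (y * a' + x' * b)).
  exists (y * y'), (y * b' + y' * b).
  split; rewrite ?mulf_neq0 //=; first by apply: GB; apply: GM.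
  + exact: GM.
  + by field; rewrite y0 y'0.
  + by field; rewrite y0 y'0.
- move=> [x [a [y [b [Gx Gy y0 /= -> ->]]]]] [x' [a' [y' [b' [Gx' Gy' y'0 /= -> ->]]]]].
  exists (x * x'), (x * a' + x' * a), (y * y'), (y * b' + y' * b).
  split; rewrite ?mulf_neq0 //=; [exact: GM|exact: GM| |]; by field; rewrite y0 y'0.
- move=> [x [a [y [b [Gx Gy y0 /= xy ->]]]]].
  have x0 : x = 0 
    by apply/eqP; move/esym/eqP: xy; rewrite mulf_eq0 invr_eq0 (negPf y0) orbF.
  by rewrite x0 in Gx *; rewrite (G0 _ Gx) !mul0r subrr mul0r.
Qed.

End Graph.

Hypothesis F0 : [pchar F] =i pred0.

Lemma natf_neq0_pchar0 n : (n.+1%:R : F) != 0.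
Proof. by rewrite ((pcharf0P F).1 F0). Qed.

Lemma deriv_neq0 p : (1 < size p)%N -> p^`() != 0.
Proof.
move=> p1; apply/negP => /eqP/polyP/(_ (size p).-2); rewrite coef_deriv coef0.
move: p1; case E: (size p) => [|[|k]] //= _; rewrite -mulr_natr => /eqP.
rewrite mulf_eq0 (negPf (natf_neq0_pchar0 _)) orbF => /eqP pk.
by have := lead_coefE p; rewrite E /= pk => /eqP; rewrite lead_coef_eq0 -size_poly_eq0 E.
Qed.

Section Adjoin.
Variable G : set (F * F).
Hypothesis hG : deriv_graph G.
Hypothesis Ginv : forall x a, G (x, a) -> exists b, G (x^-1, b).

Lemma poly_graph_deriv p q : poly_graph G p q -> poly_graph G p^`() q^`().
Proof.
by move=> Gp i; rewrite !coef_deriv; apply: (deriv_graphMn hG).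
Qed.

(** If a is transcendental over the field on which the derivation is defined, any b
    will do.  Otherwise the relation m(a) = 0 of least degree forces b, which
    exists because m'(a) is nonzero in characteristic 0; every other relation
    is a consequence, by division by m. *)
Lemma adjoin_value a :
  exists b, forall p q, poly_graph G p q -> p.[a] = 0 ->
    q.[a] + p^`().[a] * b = 0.
Proof.
case: (hG) => G1 GB GM G0.
have Gpoly0 q : poly_graph G 0 q -> q = 0.
  by move=> Gq; apply/polyP => i; rewrite coef0; apply: G0; have := Gq i; rewrite coef0.
pose alg k := `[< exists p q, [/\ poly_graph G p q, p != 0, p.[a] = 0 & size p = k] >].
case: (pselect (exists k, alg k)) => [exk|noalg]; last first.
  exists 0 => p q Gp pa; have [p0|p0] := eqVneq p 0; last first.
    by case: noalg; exists (size p); apply/asboolP; exists p, q.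
  by rewrite p0 in Gp *; rewrite (Gpoly0 _ Gp) deriv0 !horner0 mul0r addr0.
case: (ex_minnP exk) => k /asboolP [m [n [Gm m0 ma mk]]] kmin.
have min_m p q : poly_graph G p q -> p.[a] = 0 -> (size p < k)%N -> p = 0.
  move=> Gp pa; rewrite ltnNge; apply: contraNeq => p0; apply: kmin.
  by apply/asboolP; exists p, q.
have m1 : (1 < size m)%N.
  rewrite ltnNge; apply/negP => /size1_polyC mC; move: m0 ma.
  by rewrite mC hornerC => m0 m00; rewrite m00 eqxx in m0.
have dma : m^`().[a] != 0.
  apply: contra_neq (deriv_neq0 m1) => dma0.
  by apply: min_m (poly_graph_deriv Gm) dma0 _; rewrite -mk lt_size_deriv.
exists (- n.[a] / m^`().[a]); set b := (_ / _).
have hb : n.[a] + m^`().[a] * b = 0 by rewrite /b; field.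
move=> p; elim: {p}_.+1 {-2}p (ltnSn (size p)) => // N IHN p pN q Gp pa.
have [p0|p0] := eqVneq p 0.
  by rewrite p0 in Gp *; rewrite (Gpoly0 _ Gp) deriv0 !horner0 mul0r addr0.
have kp : (k <= size p)%N by rewrite leqNgt; apply: contraNN p0 => /(min_m _ _ Gp pa) ->.
(* Cancel the leading term of p with s1 = (lead p / lead m) X^(size p - size m) m. *)
have [c Gc] : exists c, G (lead_coef p / lead_coef m, c).
  have [c Gc] := Ginv (Gm (size m).-1).
  by eexists; apply: GM; [apply: (Gp (size p).-1)|rewrite lead_coefE; apply: Gc].
set l := _ / _ in Gc.
have Gs := poly_graphM hG
  (poly_graphM hG (poly_graphC hG Gc) (poly_graphXn hG (size p - size m))) Gm.
set s1 := (_ * m) in Gs; set s2 := (X in poly_graph _ _ X) in Gs.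
have s1a : s1.[a] = 0 by rewrite hornerM ma mulr0.
have s2a : s2.[a] + s1^`().[a] * b = 0.
  have -> : s2.[a] + s1^`().[a] * b =
      (l * a ^+ (size p - size m)) * (n.[a] + m^`().[a] * b).
    rewrite /s1 /s2 !derivM derivC !(hornerD, hornerM) ma horner0 !hornerC hornerXn; ring.
  by rewrite hb mulr0.
have -> : q.[a] + p^`().[a] * b = (q - s2).[a] + (p - s1)^`().[a] * b.
  by rewrite derivB !hornerD !hornerN mulrBl addrACA -opprD s2a subr0.
apply: IHN; last by rewrite hornerD hornerN s1a pa subr0.
  2: exact: poly_graphB.
apply: leq_trans (pN : size p <= N)%N.
have l0 : l != 0 by rewrite mulf_neq0 ?invr_eq0 ?lead_coef_eq0.
have s1E : s1 = l *: (m * 'X^(size p - size m)) by rewrite /s1 -mul_polyC; ring.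
have ss : size s1 = size p.
  by rewrite s1E size_scale // size_mulXn // subnK ?mk.
have ls : lead_coef s1 = lead_coef p.
  rewrite s1E lead_coefZ lead_coefM lead_coefXn mulr1 /l divfK //.
  by rewrite lead_coef_eq0.
rewrite -[size p]prednK ?size_poly_gt0 // ltnS; apply/leq_sizeP => j.
have [->|jp pj] := eqVneq j (size p).-1.
  have s1l : s1`_(size p).-1 = lead_coef p by rewrite -ls lead_coefE ss.
  by rewrite coefB s1l lead_coefE subrr.
suff jp' : (size p <= j)%N by rewrite coefB !nth_default ?subrr // ss.
by lia.
Qed.

End Adjoin.

(** Zorn's lemma: the domain of a maximal extension is closed under inverses by the
    quotient rule, and then contains every element of F by adjunction. *)
Lemma deriv_graph_extension G0 : deriv_graph G0 ->
  exists2 D, derivation D & forall x a, G0 (x, a) -> D x = a.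
Proof.
move=> hG0; pose P (G : set (F * F)) := deriv_graph (G0 `|` G)%classic.
have [|G [PG Gmax]] := @Zorn_bigcup _ P.
  move=> C CP Ctot; rewrite /P; set U := (\bigcup_(X in C) X)%classic.
  (* In a chain, two pairs lie in a common member; set0 serves when both are in G0. *)
  have two w1 w2 : (G0 `|` U)%classic w1 -> (G0 `|` U)%classic w2 ->
      exists X, [/\ P X, (G0 `|` X)%classic w1, (G0 `|` X)%classic w2 &
                    (X `<=` U)%classic].
    have P0 : P classical_sets.set0 by rewrite /P classical_sets.setU0.
    have sC X : C X -> (X `<=` U)%classic by move=> CX w Xw; exists X.
    move=> [Gw1|[X1 CX1 Xw1]] [Gw2|[X2 CX2 Xw2]].
    - by exists classical_sets.set0; split => //; left.
    - by exists X2; split; [exact: CP|left|right|exact: sC].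
    - by exists X1; split; [exact: CP|right|left|exact: sC].
    - have [X12|X21] := Ctot _ _ CX1 CX2.
      + by exists X2; split; [exact: CP|right; exact: X12|right|exact: sC].
      + by exists X1; split; [exact: CP|right|right; exact: X21|exact: sC].
  split=> [|x a y b Gx Gy|x a y b Gx Gy|a Ga].
  - by left; case: hG0.
  - have [X [[_ XB _ _] Xx Xy /setUS]] := two _ _ Gx Gy; apply; exact: XB.
  - have [X [[_ _ XM _] Xx Xy /setUS]] := two _ _ Gx Gy; apply; exact: XM.
  - by have [X [[_ _ _ X0] Xa _ _]] := two _ _ Ga Ga; apply: X0.
pose H := (G0 `|` G)%classic.
have Hmax K : (H `<=` K)%classic -> deriv_graph K -> (K `<=` H)%classic.
  move=> HK hK; apply: contrapT => nKH; apply: (Gmax K).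
    split=> [|KG]; last by apply: nKH => w /KG; right.
    by move=> w Gw; apply: HK; right.
  by rewrite /P classical_sets.setUidr // => w Gw; apply: HK; left.
have Hinv x a : H (x, a) -> exists b, H (x^-1, b).
  move=> Hx; have [->|x0] := eqVneq x 0.
    by exists 0; rewrite invr0; apply: deriv_graph0.
  exists ((0 * x - 1 * a) / x ^+ 2).
  apply: (Hmax _ (sub_frac_graph PG) (frac_deriv_graph PG)).
  by exists 1, 0, x, a; split; rewrite ?div1r //; case: PG.
have Htot a : exists b, H (a, b).
  have [b hb] := adjoin_value PG Hinv a; exists b.
  apply: (Hmax _ (@sub_adjoin_graph _ PG a b) (adjoin_deriv_graph PG hb)).
  exact: adjoin_graph_gen.
have [D HD] := choice Htot; exists D; last first.
  by move=> x a G0x; apply: (deriv_graph_fun PG (HD x)); left.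
case: (PG) => _ HB HM _; split=> x y; apply: (deriv_graph_fun PG (HD _)).
  exact: HB (HD x) (HD y).
exact: HM (HD x) (HD y).
Qed.

End DerivationExtension.

(** * Derivations and algebraic independence *)

Section DerivationTheory.
Variable F : fieldType.
Implicit Types (D : F -> F) (a b x y : F) (s : seq F).

Lemma derivation0 D : derivation D -> D 0 = 0.
Proof. by case=> DB _; rewrite -(subrr 0) DB !subrr. Qed.

Lemma derivationN D x : derivation D -> D (- x) = - D x.
Proof. by move=> hD; have [DB _] := hD; rewrite -sub0r DB derivation0 // sub0r. Qed.

Lemma derivationD D x y : derivation D -> D (x + y) = D x + D y.
Proof.
move=> hD; have -> : x + y = x - - y by rewrite opprK.
by rewrite hD.1 (derivationN y hD) opprK.
Qed.

Lemma derivation1 D : derivation D -> D 1 = 0.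
Proof.
move=> [_ DM]; have := DM 1 1; rewrite !mul1r => /eqP.
by rewrite -subr_eq0 opprD addrA subrr sub0r oppr_eq0 => /eqP.
Qed.

Lemma derivation_cst0 : derivation (fun=> 0 : F).
Proof. by split=> *; rewrite ?mulr0 ?subrr ?addr0. Qed.

Lemma derivation_comb D D' a b : derivation D -> derivation D' ->
  derivation (fun x => a * D x + b * D' x).
Proof.
move=> [DB DM] [DB' DM']; split=> x y; first by rewrite DB DB'; ring.
by rewrite DM DM'; ring.
Qed.

Lemma derivation_sum (I : Type) (r : seq I) (c : I -> F) (D : I -> F -> F) :
  (forall i, derivation (D i)) -> derivation (fun x => \sum_(i <- r) c i * D i x).
Proof.
move=> hD; elim: r => [|i r IHr].
  by split=> *; rewrite !big_nil ?mulr0 ?subrr ?addr0.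
have [SB SM] := IHr; have [DB DM] := hD i.
by split=> x y; rewrite !big_cons ?SB ?SM ?DB ?DM; ring.
Qed.

Lemma derivation_inv D x : derivation D -> x != 0 -> D x^-1 = - D x / x ^+ 2.
Proof.
move=> hD x0; have := hD.2 x x^-1; rewrite divff // (derivation1 hD) => h.
have -> : D x^-1 = (x * D x^-1 + x^-1 * D x) / x - D x / x ^+ 2 by field.
by rewrite -h mul0r sub0r mulNr.
Qed.

End DerivationTheory.

Section Independence.
Variable F : fieldType.
Hypothesis F0 : [pchar F] =i pred0.

(** Algebraic independence over the prime field, with denominators cleared. *)
Definition int_independent n (z : 'I_n -> F) : Prop :=
  forall p : {mpoly int[n]}, mmap intr z p = 0 -> p = 0.

(** The partial derivative with respect to the j-th variable is well defined on
    the polynomials in z, and extends to F. *)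
Lemma dual_derivation n (z : 'I_n -> F) (j : 'I_n) : int_independent z ->
  exists2 D, derivation D & forall k, D (z k) = (j == k)%:R.
Proof.
move=> hz.
pose G (w : F * F) := exists p, w.1 = mmap intr z p /\ w.2 = mmap intr z p^`M(j).
have [|D hD DG] := @deriv_graph_extension F F0 G.
  split=> [|x a y b [p [/= -> ->]] [q [/= -> ->]]
         |x a y b [p [/= -> ->]] [q [/= -> ->]]|a [p [/= p0 ->]]].
  - by exists 1; rewrite /= -mpolyC1 mderivC mmapC mmap0.
  - by exists (p - q); rewrite !mderivB !mmapB.
  - by exists (p * q); rewrite mderivM !mmapD !rmorphM /=; split=> //; ring.
  - by rewrite (hz p) // mderiv0 mmap0.
exists D => // k; rewrite (DG _ ((j == k)%:R)) //.
exists 'X_k; rewrite mmapX mmap1U; split=> //=.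
rewrite mderivX mnm1E eq_sym; case: eqP => [->|_] /=; last by rewrite scale0r mmap0.
have U0 i : (U_(i) - U_(i) = 0 :> 'X_{1..n})%MM.
  by apply/mnmP => l; rewrite mnmBE subnn mnm0E.
by rewrite U0 scale1r mpolyX0 -mpolyC1 mmapC.
Qed.

Variable S : F -> Prop.
Hypothesis Sind : forall n, exists z : 'I_n -> F,
  (forall i, S (z i)) /\ int_independent z.

(** With more independent elements than there are elements of s, some nontrivial
    combination of the dual derivations kills s; it is nonzero on some z_j. *)
Lemma new_derivation (s : seq F) :
  exists x, S x /\ exists D, [/\ derivation D, forall y, y \in s -> D y = 0 & D x = 1].
Proof.
have [z [Sz hz]] := Sind (size s).+1.
have /choice [D hD] : forall j, exists D, derivation D /\ forall k, D (z k) = (j == k)%:R.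
  by move=> j; have [D dD hD] := dual_derivation j hz; exists D.
pose A := \matrix_(j < (size s).+1, i < size s) D j s`_i.
have : kermx A != 0.
  by rewrite -mxrank_eq0 mxrank_ker subn_eq0 -ltnNge ltnS rank_leq_col.
case/rowV0Pn => c /sub_kermxP cA c0.
have [j cj] : exists j, c 0 j != 0.
  apply/existsP; apply: contraNT c0; rewrite negb_exists => /forallP c0.
  by apply/eqP/rowP => j; rewrite mxE; apply/eqP; have := c0 j; rewrite negbK.
pose E x := \sum_k (c 0 k / c 0 j) * D k x.
exists (z j); split=> //; exists E; split.
- by apply: derivation_sum => k; case: (hD k).
- move=> y /(nthP 0) [i si <-].
  have /matrixP/(_ 0 (Ordinal si)) := cA; rewrite !mxE => cA0.
  have -> : E s`_i = (c 0 j)^-1 * \sum_k c 0 k * A k (Ordinal si).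
    rewrite /E mulr_sumr; apply: eq_bigr => k _.
    by rewrite mxE mulrA [_^-1 * _]mulrC.
  by rewrite cA0 mulr0.
- rewrite /E (bigD1 j) //= big1 => [|k kj]; last by rewrite (hD k).2 (negPf kj) mulr0.
  by rewrite (hD j).2 eqxx mulr1 addr0 divff.
Qed.

(** Each new term of the sequence comes with a derivation that kills t and the
    earlier terms.  Triangular combinations of these take prescribed values on
    longer and longer initial segments.  Let E_N be the subfield of the elements
    that are killed by every derivation killing t and the first N terms: on E_N
    all these combinations agree from the N-th on.  The derivation so defined on
    the union of the E_N extends to F. *)
Lemma free_sequence t :
  exists x : nat -> F, (forall i, S (x i)) /\
    forall c : nat -> F, exists D, [/\ derivation D, D t = 0 & forall i, D (x i) = c i].
Proof.
have /choice [X hX] := new_derivation.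
have /choice [D hD] : forall s, exists D,
    [/\ derivation D, forall y, y \in s -> D y = 0 & D (X s) = 1].
  by move=> s; case: (hX s).
pose s N := iter N (fun s => X s :: s) [:: t].
have ts N : t \in s N by elim: N => [|N IHN]; rewrite /= inE ?eqxx // IHN orbT.
exists (fun N => X (s N)); split=> [i|c]; first by case: (hX (s i)).
pose E := fix E N := if N is M.+1 then
   fun x => 1 * E M x + (c M - E M (X (s M))) * D (s M) x else fun=> 0.
have hE N : derivation (E N).
  elim: N => [|N IHN]; first exact: derivation_cst0.
  by apply: derivation_comb => //; case: (hD (s N)).
(* The union over N of the restrictions of E N to the elements killed by every
   derivation that kills s N. *)
pose G (w : F * F) := exists N,
  (forall D', derivation D' -> (forall y, y \in s N -> D' y = 0) -> D' w.1 = 0) /\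
  w.2 = E N w.1.
have sub N N' : (N <= N')%N -> {subset s N <= s N'}.
  move/subnK <-; elim: (_ - _)%N => // k IHk y /IHk ys; by rewrite inE ys orbT.
have EN N N' x : (N <= N')%N ->
    (forall D', derivation D' -> (forall y, y \in s N -> D' y = 0) -> D' x = 0) ->
    E N' x = E N x.
  move=> NN' hx; elim: N' NN' => [|N' IH]; first by rewrite leqn0 => /eqP ->.
  rewrite leq_eqVlt => /predU1P[->//|NN']; rewrite /= IH // mul1r.
  have [dD kD _] := hD (s N'); rewrite (hx _ dD) ?mulr0 ?addr0 // => y ys.
  by apply: kD; apply: (sub N).
have [|D' hD' GD'] := @deriv_graph_extension F F0 G.
  split=> [|x a y b [N [/= hx ->]] [N' [/= hy ->]]
         |x a y b [N [/= hx ->]] [N' [/= hy ->]]|a [N [/= _ ->]]].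
  - exists 0%N; split=> //= D' hD' _; exact: derivation1.
  - exists (maxn N N'); split=> /= [D' hD' kD'|].
      rewrite hD'.1 (hx _ hD') ?(hy _ hD') ?subrr // => u us; apply: kD'.
        exact: sub (leq_maxr N N') _ us.
      exact: sub (leq_maxl N N') _ us.
    by rewrite (hE _).1 (EN N _ x (leq_maxl _ _) hx) (EN N' _ y (leq_maxr _ _) hy).
  - exists (maxn N N'); split=> /= [D' hD' kD'|].
      rewrite hD'.2 (hx _ hD') ?(hy _ hD') ?mulr0 ?addr0 // => u us; apply: kD'.
        exact: sub (leq_maxr N N') _ us.
      exact: sub (leq_maxl N N') _ us.
    by rewrite (hE _).2 (EN N _ x (leq_maxl _ _) hx) (EN N' _ y (leq_maxr _ _) hy).
  - exact: derivation0.
exists D'; split=> //.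
  rewrite (GD' t 0) //; exists 0%N; split=> //= D'' _; apply; exact: (ts 0%N).
move=> i; rewrite (GD' _ (c i)) //; exists i.+1; split=> /=.
  by move=> D'' _; apply; rewrite inE eqxx.
by have [_ _ ->] := hD (s i); ring.
Qed.
End Independence.

(** * Discrete valuation rings and their fractions *)

Lemma frac_repr (A : idomainType) (x : {fraction A}) :
  exists a b : A, b != 0 /\ x = tofrac a / tofrac b.
Proof.
elim/quotW: x => x; exists \n_x, \d_x; split; first exact: denom_ratioP.
have d0 : tofrac \d_x != 0 by rewrite tofrac_eq0 denom_ratioP.
suff <- : ((\pi_(FracField.type A) x)%qT : {fraction A}) * tofrac \d_x = tofrac \n_x.
  by rewrite mulfK.
unlock FracField.tofrac; rewrite -[LHS]FracField.pi_mul.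
apply/eqP; rewrite FracField.equivf_def /FracField.mulf.
by rewrite !numden_Ratio ?(oner_neq0, mulf_neq0, denom_ratioP) // !mulr1 mulrC.
Qed.

Lemma tofrac_inj (A : idomainType) : injective (@tofrac A).
Proof. by move=> a b /eqP; rewrite tofrac_eq => /eqP. Qed.

(** The universal property of the fraction field. *)
Lemma fraction_lift (A : idomainType) (K : fieldType) (f : {rmorphism A -> K}) :
  injective f -> exists g : {rmorphism {fraction A} -> K},
    forall a, g (tofrac a) = f a.
Proof.
move=> finj.
have f0 a : a != 0 -> f a != 0 by rewrite -(rmorph0 f) (inj_eq finj).
have t0 (a : A) : a != 0 -> tofrac a != 0 by rewrite tofrac_eq0.
have /choice [g hg] : forall x : {fraction A}, exists y : K,
    forall a b : A, b != 0 -> x = tofrac a / tofrac b -> y = f a / f b.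
  move=> x; have [a [b [b0 ->]]] := frac_repr x; exists (f a / f b) => a' b' b'0 /eqP.
  rewrite eqr_div ?t0 // -!tofracM tofrac_eq => /eqP /(congr1 f).
  by rewrite !rmorphM => h; apply/eqP; rewrite eqr_div ?f0 //; apply/eqP.
have gf a : g (tofrac a) = f a.
  by rewrite (hg _ a 1) ?oner_neq0 ?rmorph1 ?tofrac1 ?divr1.
have fieldD (L : fieldType) (a b a' b' : L) : b != 0 -> b' != 0 ->
    a / b - a' / b' = (a * b' - a' * b) / (b * b').
  by move=> b0 b'0; field; rewrite b0 b'0.
have gB : zmod_morphism g.
  move=> x y; have [a [b [b0 xab]]] := frac_repr x; have [a' [b' [b'0 yab]]] := frac_repr y.
  rewrite (hg _ _ _ b0 xab) (hg _ _ _ b'0 yab) fieldD ?f0 //.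
  rewrite -!rmorphM -rmorphB; apply: hg; first by rewrite mulf_neq0.
  by rewrite xab yab fieldD ?t0 // tofracB !tofracM.
have gM : monoid_morphism g.
  split=> [|x y]; first by rewrite -tofrac1 gf rmorph1.
  have [a [b [b0 xab]]] := frac_repr x; have [a' [b' [b'0 yab]]] := frac_repr y.
  rewrite (hg _ _ _ b0 xab) (hg _ _ _ b'0 yab) mulf_div -!rmorphM.
  apply: hg; first by rewrite mulf_neq0.
  by rewrite xab yab mulf_div !tofracM.
pose G : {rmorphism {fraction A} -> K} := HB.pack g
  (GRing.isZmodMorphism.Build _ _ g gB) (GRing.isMonoidMorphism.Build _ _ g gM).
by exists G.
Qed.

(** Among domains, the existence of such a t characterizes the discrete valuation
    rings; divisibility by powers of t stands for the valuation below. *)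
Definition uniformizer (V : idomainType) (t : V) : Prop :=
  [/\ t != 0, t \isn't a GRing.unit &
      forall a, a != 0 -> exists m u, u \is a GRing.unit /\ a = t ^+ m * u].

(** An element of value 1; the elements of value 0 of F are the units of V. *)
Lemma DVR_uniformizer (V : idomainType) : is_DVR V -> exists t : V, uniformizer t.
Proof.
case=> v [vM _ vsurj] vV.
have v1 : v 1 = 0.
  have := vM 1 1 (oner_neq0 _) (oner_neq0 _); rewrite mulr1.
  by move: (v 1) => w h; lia.
have vV0 x : x != 0 -> v x^-1 = - v x.
  by move=> x0; have := vM x x^-1 x0; rewrite invr_eq0 divff // v1 => /(_ x0) h; lia.
have unitP (a : V) : a != 0 -> v (tofrac a) = 0 -> a \is a GRing.unit.
  move=> a0 va; have fa0 : tofrac a != 0 by rewrite tofrac_eq0.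
  have [b ab] : exists b : V, (tofrac a)^-1 = tofrac b.
    by apply/vV; right; rewrite vV0 // va.
  apply/unitrP; exists b; rewrite [b * a]mulrC.
  suff: a * b = 1 by [].
  by apply/eqP; rewrite -tofrac_eq tofracM tofrac1 -ab divff.
have [x x0 vx] := vsurj 1.
have [t xt] : exists t : V, x = tofrac t by apply/vV; right; rewrite vx.
have t0 : t != 0 by rewrite -tofrac_eq0 -xt.
have vX m : v (x ^+ m) = m%:Z.
  elim: m => [|m IHm]; first by rewrite expr0.
  by rewrite exprS vM ?expf_neq0 // vx IHm; lia.
exists t; split=> //.
  apply/negP => /unitrP [s [st _]].
  have s0 : s != 0 by apply: contra_eq_neq st => ->; rewrite mul0r eq_sym oner_neq0.
  have : tofrac s * x = 1 by rewrite xt -tofracM st tofrac1.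
  move/(congr1 v); rewrite vM ?tofrac_eq0 // vx v1.
  have [|/eqP|] := (vV (tofrac s)).1; [by exists s|by rewrite tofrac_eq0 (negPf s0)|].
  by move=> h1 h2; lia.
move=> a a0; have fa0 : tofrac a != 0 by rewrite tofrac_eq0.
have va : 0 <= v (tofrac a).
  by have [|/eqP|//] := (vV (tofrac a)).1; [exists a|rewrite (negPf fa0)].
pose m := `|v (tofrac a)|%N.
have vxm : v (tofrac a / x ^+ m) = 0.
  by rewrite vM ?vV0 ?vX ?invr_eq0 ?expf_neq0 // /m; lia.
have [u au] : exists u : V, tofrac a / x ^+ m = tofrac u.
  by apply/vV; right; rewrite vxm.
have u0 : u != 0.
  by rewrite -tofrac_eq0 -au mulf_neq0 ?invr_eq0 ?expf_neq0.
exists m, u; split; first by apply: unitP => //; rewrite -au.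
apply/eqP; rewrite -tofrac_eq tofracM tofracXn -xt -au mulrC divfK //.
by rewrite expf_neq0.
Qed.

Section Uniformizer.
Variables (V : idomainType) (t : V).
Hypothesis ht : uniformizer t.

Definition tdvd (m : nat) (a : V) : Prop := exists c, a = t ^+ m * c.

Lemma tdvd0 m : tdvd m 0.
Proof. by exists 0; rewrite mulr0. Qed.

Lemma tdvdB m a b : tdvd m a -> tdvd m b -> tdvd m (a - b).
Proof. by move=> [c ->] [d ->]; exists (c - d); rewrite mulrBr. Qed.

Lemma tdvdN m a : tdvd m a -> tdvd m (- a).
Proof. by move=> [c ->]; exists (- c); rewrite mulrN. Qed.

Lemma tdvdD m a b : tdvd m a -> tdvd m b -> tdvd m (a + b).
Proof. by move=> [c ->] [d ->]; exists (c + d); rewrite mulrDr. Qed.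

Lemma tdvd_sum m (I : Type) (r : seq I) (P : pred I) (f : I -> V) :
  (forall i, P i -> tdvd m (f i)) -> tdvd m (\sum_(i <- r | P i) f i).
Proof.
move=> hf; elim/big_rec: _ => [|i x Pi]; first exact: tdvd0.
by apply: tdvdD; apply: hf.
Qed.

Lemma tdvdM m k a b : tdvd m a -> tdvd k b -> tdvd (m + k) (a * b).
Proof. by move=> [c ->] [d ->]; exists (c * d); rewrite exprD; ring. Qed.

Lemma tdvdMl m a b : tdvd m b -> tdvd m (a * b).
Proof. by move=> [c ->]; exists (a * c); ring. Qed.

Lemma tdvdMr m a b : tdvd m a -> tdvd m (a * b).
Proof. by rewrite mulrC; apply: tdvdMl. Qed.

Lemma tdvdW k m a : (k <= m)%N -> tdvd m a -> tdvd k a.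
Proof. by move=> /subnKC <- [c ->]; exists (t ^+ (m - k) * c); rewrite exprD mulrA. Qed.

Lemma tdvdX m : tdvd m (t ^+ m).
Proof. by exists 1; rewrite mulr1. Qed.

Lemma tX_neq0 m : t ^+ m != 0.
Proof. by case: ht => t0 _ _; rewrite expf_neq0. Qed.

Lemma tdvd1P a : reflect (~ tdvd 1 a) (a \is a GRing.unit).
Proof.
case: ht => t0 tU tV; apply: (iffP idP) => [aU [c ac]|nt].
  by move: aU; rewrite ac unitrM expr1 (negPf tU).
have [a0|/tV [[|m] [u [uU au]]]] := eqVneq a 0; first by case: nt; rewrite a0; apply: tdvd0.
  by rewrite au mul1r.
by case: nt; exists (t ^+ m * u); rewrite au exprS expr1 mulrA.
Qed.

Lemma not_tdvdS_X m : ~ tdvd m.+1 (t ^+ m).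
Proof.
case: ht => t0 tU _ [c]; rewrite exprSr -mulrA -{1}[t ^+ m]mulr1 => /(mulfI (tX_neq0 m)) h.
by move: tU; rewrite -[_ \is a _]andTb; case/negP; apply/unitrP; exists c; rewrite mulrC.
Qed.

(** An element of S of least value.  When S is contained in {0}, that element is 0
    and divisibility still holds. *)
Lemma exists_tdvd_min (S : V -> Prop) : (exists x, S x) ->
  exists x, S x /\ forall y, S y -> exists c, y = x * c.
Proof.
move=> [x0 Sx0].
have [[x1 [Sx1 x10]]|noS] := pselect (exists x, S x /\ x != 0); last first.
  exists x0; split=> // y Sy; exists 0; rewrite mulr0.
  apply/eqP; apply: contra_notT noS => y0.
  by exists y.
pose P m := `[< exists x u, [/\ S x, u \is a GRing.unit & x = t ^+ m * u] >].
have exP : exists m, P m.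
  case: ht => _ _ /(_ _ x10) [m [u [uU xu]]].
  by exists m; apply/asboolP; exists x1, u.
case: (ex_minnP exP) => m /asboolP [x [u [Sx uU xu]]] mmin.
exists x; split=> // y Sy; have [->|y0] := eqVneq y 0; first by exists 0; rewrite mulr0.
case: ht => _ _ /(_ _ y0) [k [w [wU yw]]].
have mk : (m <= k)%N by apply: mmin; apply/asboolP; exists y, w.
exists (t ^+ (k - m) * w / u); rewrite xu yw -{1}(subnKC mk) exprD.
rewrite -[t ^+ m * u * _]mulrA; rewrite [u * _]mulrC divrK //.
by rewrite mulrA.
Qed.

Local Notation F := {fraction V}.
Implicit Types x y : F.

(** The fractions that lie in V. *)
Definition integral_frac x : Prop := exists a : V, x = tofrac a.

Lemma integral_fracB x y : integral_frac x -> integral_frac y -> integral_frac (x - y).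
Proof. by move=> [a ->] [b ->]; exists (a - b); rewrite tofracB. Qed.

Lemma integral_fracM x y : integral_frac x -> integral_frac y -> integral_frac (x * y).
Proof. by move=> [a ->] [b ->]; exists (a * b); rewrite tofracM. Qed.

Lemma integral_frac0 : integral_frac 0.
Proof. by exists 0; rewrite tofrac0. Qed.

Lemma integral_fracD x y : integral_frac x -> integral_frac y -> integral_frac (x + y).
Proof. by move=> [a ->] [b ->]; exists (a + b); rewrite tofracD. Qed.

Lemma integral_frac_sum (I : Type) (r : seq I) (P : pred I) (f : I -> F) :
  (forall i, P i -> integral_frac (f i)) -> integral_frac (\sum_(i <- r | P i) f i).
Proof.
move=> hf; elim/big_rec: _ => [|i x Pi]; first exact: integral_frac0.
by apply: integral_fracD; apply: hf.
Qed.

Lemma integral_fracX m : integral_frac ((tofrac t) ^+ m).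
Proof. by exists (t ^+ m); rewrite tofracXn. Qed.

Lemma clear_pole x : exists m, integral_frac (tofrac t ^+ m * x).
Proof.
have [a [b [b0 ->]]] := frac_repr x.
case: ht => t0 _ /(_ _ b0) [m [u [uU ->]]]; exists m, (a / u).
have u0 : tofrac u != 0 by rewrite tofrac_eq0; apply: contraTneq uU => ->; rewrite unitr0.
have cancel (K : fieldType) (p y z : K) : p != 0 -> z != 0 -> p * (y / (p * z)) * z = y.
  by move=> p0 z0; field; rewrite p0 z0.
apply/(mulIf u0); rewrite -[RHS]tofracM divrK // tofracM tofracXn.
by apply: cancel => //; rewrite expf_neq0 ?tofrac_eq0.
Qed.

Lemma clear_poles (I : finType) (f : I -> F) :
  exists m, forall i, integral_frac (tofrac t ^+ m * f i).
Proof.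
have /choice [m hm] := fun i => clear_pole (f i).
exists (\max_i m i) => i; rewrite -(subnK (leq_bigmax i)) exprD -mulrA.
by apply: integral_fracM => //; apply: integral_fracX.
Qed.

End Uniformizer.

(** If y is not in V, then y c = 1 for a multiple c of t.  Multiplying a monic equation
    of degree N for y by c^N gives that t divides 1. *)
Lemma uniformizer_integrally_closed (V : idomainType) (t : V) (p : {poly V})
    (y : {fraction V}) : uniformizer t -> p \is monic ->
  root (map_poly (@tofrac V) p) y -> integral_frac y.
Proof.
move=> ht pm /rootP py; have [a [b [b0 yab]]] := frac_repr y.
have [t0 tU tV] := ht.
have [a0|a0] := eqVneq a 0; first by rewrite yab a0 tofrac0 mul0r; apply: integral_frac0.
have [i [u [uU au]]] := tV a a0; have [j [w [wU bw]]] := tV b b0.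
have [ji|ij] := leqP j i.
  exists (t ^+ (i - j) * u / w); rewrite yab; apply: canLR (mulfK _) _.
    by rewrite tofrac_eq0.
  rewrite -tofracM au bw -{1}(subnK ji) exprD.
  by rewrite [t ^+ j * w]mulrC mulrA divrK // mulrAC.
have [c tc yc] : exists2 c, tdvd t 1 c & y * tofrac c = 1.
  exists (t ^+ 1 * (t ^+ (j - i.+1) * w / u)); first by exists (t ^+ (j - i.+1) * w / u).
  apply: (@mulIf _ (tofrac b)); first by rewrite tofrac_eq0.
  rewrite mul1r yab mulrAC divfK ?tofrac_eq0 // -tofracM au bw.
  rewrite expr1 -{2}(subnKC ij) exprD exprSr; congr tofrac.
  transitivity (t ^+ i * t * t ^+ (j - i.+1) * w * (u / u)); first by ring.
  by rewrite divrr // mulr1.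
have [N pN] : exists N, size p = N.+1.
  by exists (size p).-1; rewrite prednK // size_poly_gt0 monic_neq0.
have : tofrac (\sum_(l < N.+1) p`_l * c ^+ (N - l)) = 0.
  transitivity ((map_poly (@tofrac V) p).[y] * tofrac c ^+ N); last by rewrite py mul0r.
  rewrite (@horner_coef_wide _ N.+1) -?pN ?size_poly // pN mulr_suml rmorph_sum.
  apply: eq_bigr => l _.
  rewrite coef_map /= tofracM tofracXn /= -mulrA; congr (_ * _).
  have -> : tofrac c ^+ N = tofrac c ^+ l * tofrac c ^+ (N - l).
    by rewrite -exprD subnKC // -ltnS.
  rewrite mulrA -exprMn yc.
  by rewrite expr1n mul1r.
move/eqP; rewrite tofrac_eq0 big_ord_recr /= subnn expr0 mulr1.
have -> : p`_N = 1 by move/monicP: pm; rewrite lead_coefE pN.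
move/eqP => sum0; case: (not_tdvdS_X ht (m := 0)); rewrite expr0.
have -> : 1 = - \sum_(l < N) p`_l * c ^+ (N - l).
  by apply/eqP; rewrite -subr_eq0 opprK addrC sum0.
apply/tdvdN/tdvd_sum => l _; apply: tdvdMl.
rewrite -(subnK (_ : 0 < N - l)%N) ?subn_gt0 // exprD expr1.
exact: tdvdMl.
Qed.

(** * The subring cut out by a family of derivations *)

(** Bundling the derivations with the proof that they are derivations lets the ring
    structure of the subring below be inferred from its type. *)
Record derivations (F : fieldType) (n : nat) := Derivations {
  ders :> 'I_n -> F -> F;
  dersP : forall j, derivation (ders j) }.

Section Twisted.
Variables (V : idomainType) (n : nat) (D : derivations {fraction V} n).

Definition twisted_pred : {pred V} :=
  fun a => `[< forall j, integral_frac (D j (tofrac a)) >].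

(** Closure under inverses holds in V, where the inverse of a nonunit is the nonunit
    itself: D(1/b) = - D b / b^2 lies in V when b is a unit of V. *)
Lemma twisted_divring_closed : divring_closed twisted_pred.
Proof.
split=> [|a b /asboolP Ta /asboolP Tb|a b /asboolP Ta /asboolP Tb].
- apply/asboolP => j; rewrite tofrac1 (derivation1 (dersP D j)).
  exact: integral_frac0.
- apply/asboolP => j; rewrite tofracB (dersP D j).1.
  exact: integral_fracB.
- apply/asboolP => j; rewrite tofracM (dersP D j).2.
  suff TbV : integral_frac (D j (tofrac b^-1)).
    by apply: integral_fracD; apply: integral_fracM => //; eexists.
  have [bU|bU] := boolP (b \is a GRing.unit); last by rewrite invr_out.
  have fb0 : tofrac b != 0.
    by rewrite tofrac_eq0; apply: contraTneq bU => ->; rewrite unitr0.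
  have fbV : tofrac b^-1 = (tofrac b)^-1.
    by apply: (mulfI fb0); rewrite -tofracM divrr // divff // tofrac1.
  rewrite fbV (derivation_inv (dersP D j) fb0) mulNr -mulrN.
  apply: integral_fracM => //; exists (- b^-1 ^+ 2).
  by rewrite tofracN tofracXn fbV exprVn.
Qed.

HB.instance Definition _ :=
  GRing.isDivringClosed.Build V twisted_pred twisted_divring_closed.

Definition twisted := {a : V | a \in twisted_pred}.
HB.instance Definition _ := SubType.on twisted.
HB.instance Definition _ := Choice.on twisted.
HB.instance Definition _ := [SubChoice_isSubIntegralDomain of twisted by <:].

End Twisted.

(** R embeds by r |-> (e r, d_1 r, ..., d_n r) in the trivial extension of V by V^n
    as a t-adically dense subring [split_approx] that is closed under division by t
    [split_dvd] and by units of V [split_unit], and V is contained in R[1/t]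
    [split_conductor]. *)
Record analytically_split (V R : idomainType) (t : V) (n : nat) (e : {rmorphism R -> V})
   (d : 'I_n -> R -> V) (tau : R) : Prop := AnalyticallySplit {
  split_inj : injective e;
  split_unit : forall r, e r \is a GRing.unit -> r \is a GRing.unit;
  split_dB : forall j r s, d j (r - s) = d j r - d j s;
  split_dM : forall j r s, d j (r * s) = e r * d j s + e s * d j r;
  split_tau : e tau = t;
  split_dtau : forall j, d j tau = 0;
  split_approx : forall m a (b : 'I_n -> V), exists r,
    tdvd t m (e r - a) /\ forall j, tdvd t m (d j r - b j);
  split_dvd : forall r, tdvd t 1 (e r) -> (forall j, tdvd t 1 (d j r)) ->
    exists s, r = tau * s;
  split_conductor : forall a, exists m r, e r = t ^+ m * a }.

Section TwistedSplit.
Variables (V : idomainType) (t : V) (n : nat) (D : derivations {fraction V} n).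
Hypothesis ht : uniformizer t.
Hypothesis Dt : forall j, D j (tofrac t) = 0.
Hypothesis Dpole : forall j m, exists k (u : V), (m <= k)%N /\
  forall i, D i (tofrac u) = (i == j)%:R / tofrac t ^+ k.

Let ft0 : tofrac t != 0. Proof. by case: ht => t0 _ _; rewrite tofrac_eq0. Qed.

Lemma derXt j m : D j (tofrac t ^+ m) = 0.
Proof.
elim: m => [|m IHm]; first by rewrite expr0 (derivation1 (dersP D j)).
by rewrite exprS (dersP D j).2 IHm Dt !mulr0 addr0.
Qed.

Lemma derMXt j m x : D j (tofrac t ^+ m * x) = tofrac t ^+ m * D j x.
Proof. by rewrite (dersP D j).2 derXt mulr0 addr0. Qed.

Lemma der_sum j (I : Type) (r : seq I) (f : I -> {fraction V}) :
  D j (\sum_(i <- r) f i) = \sum_(i <- r) D j (f i).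
Proof.
elim: r => [|i r IHr]; first by rewrite !big_nil (derivation0 (dersP D j)).
by rewrite !big_cons (derivationD _ _ (dersP D j)) IHr.
Qed.

(** With D_i u_j equal to t^-k when i = j and to 0 otherwise, the sum v of the
    t^k z_j u_j satisfies D_i v = z_i + sum_j t^k u_j D_i z_j, and k is chosen so
    large that t^k clears the poles of all z_j and D_i z_j.  Approximation modulo
    higher powers of t follows by scaling. *)
Lemma der_dense (z : 'I_n -> {fraction V}) : exists v : V,
  forall j, integral_frac (D j (tofrac v) - z j).
Proof.
(* All the elements whose poles t^k has to clear. *)
pose f (w : 'I_n * option 'I_n) := if w.2 is Some k then D k (z w.1) else z w.1.
have [m hm] := clear_poles ht f.
have /choice [k /choice [u hu]] := fun j => Dpole j m.
have hk j w : integral_frac (tofrac t ^+ k j * f w).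
  have [mk _] := hu j; rewrite -(subnK mk) exprD -mulrA.
  by apply: integral_fracM => //; apply: integral_fracX.
pose v j := tofrac t ^+ k j * z j * tofrac (u j).
have [a va] : exists a : V, \sum_j v j = tofrac a.
  apply: integral_frac_sum => j _; apply: integral_fracM; last by exists (u j).
  exact: (hk j (j, None)).
exists a => i; rewrite -va der_sum.
have -> : \sum_j D i (v j) - z i = \sum_j (tofrac t ^+ k j * D i (z j) * tofrac (u j)).
  have -> : z i = \sum_j (i == j)%:R * z j.
    rewrite (bigD1 i) //= eqxx mul1r big1 ?addr0 // => j; rewrite eq_sym => /negPf ->.
    by rewrite mul0r.
  rewrite -sumrB; apply: eq_bigr => j _.
  rewrite /v -mulrA derMXt (dersP D i).2 (hu j).2.
  have cancel (K : fieldType) (p x y x' q : K) : p != 0 ->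
      p * (x * (q / p) + y * x') - q * x = p * x' * y by move=> p0; field.
  by rewrite cancel // expf_neq0.
apply: integral_frac_sum => j _; apply: integral_fracM; last by exists (u j).
exact: (hk j (j, Some i)).
Qed.

Lemma twisted_der_subproof j (r : twisted D) : exists a, D j (tofrac (val r)) = tofrac a.
Proof. by case: r => a Ta /=; move/asboolP: (Ta); apply. Qed.

Definition twisted_der j (r : twisted D) : V := sval (cid (twisted_der_subproof j r)).

Lemma tofrac_twisted_der j r : tofrac (twisted_der j r) = D j (tofrac (val r)).
Proof. by rewrite /twisted_der; case: cid. Qed.

Lemma twisted_mem (a : V) (b : 'I_n -> V) :
  (forall j, D j (tofrac a) = tofrac (b j)) ->
  exists r : twisted D, val r = a /\ forall j, twisted_der j r = b j.
Proof.
move=> h; have Ta : a \in twisted_pred D by apply/asboolP => j; exists (b j).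
exists (Sub a Ta); split=> [|j]; first by rewrite SubK.
by apply: tofrac_inj; rewrite tofrac_twisted_der SubK.
Qed.

(** Since D_j t = 0, approximating (b - D a) / t^m up to V by some D v approximates
    (a, b) up to t^m by a + t^m v and its derivatives. *)
Lemma twisted_split : exists (d : 'I_n -> twisted D -> V) (tau : twisted D),
  analytically_split t (val : {rmorphism twisted D -> V}) d tau.
Proof.
have [|tau [vtau dtau]] := @twisted_mem t (fun=> 0).
  by move=> j; rewrite Dt tofrac0.
exists twisted_der, tau; split=> //.
- exact: val_inj.
- move=> j r s; apply: tofrac_inj.
  by rewrite tofracB !tofrac_twisted_der [tofrac (val _)]tofracB (dersP D j).1.
- move=> j r s; apply: tofrac_inj.
  by rewrite tofracD !tofracM !tofrac_twisted_der [tofrac (val _)]tofracM (dersP D j).2.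
- move=> m a b.
  have [v hv] := der_dense (fun j => (tofrac (b j) - D j (tofrac a)) / tofrac t ^+ m).
  have /choice [c hc] := hv.
  have [|r [vr dr]] := @twisted_mem (a + t ^+ m * v) (fun j => b j + t ^+ m * c j).
    move=> j; have cancel (K : fieldType) (p x y z : K) : p != 0 ->
        x + p * z = y + p * (z - (y - x) / p) by move=> p0; field.
    rewrite !tofracD !tofracM (derivationD _ _ (dersP D j)) tofracXn derMXt -hc.
    by rewrite -cancel // expf_neq0.
  exists r; rewrite /= vr; split=> [|j].
    by exists v; rewrite addrAC subrr add0r.
  by exists (c j); rewrite dr addrAC subrr add0r.
- move=> r [a ra] /choice [b rb].
  have ra' : val r = t * a by rewrite -[t]expr1.
  have [|s [vs ds]] := @twisted_mem a b.
    move=> j; apply: (mulfI ft0); have := derMXt j 1 (tofrac a); rewrite expr1 => <-.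
    by rewrite -tofracM -ra' -tofrac_twisted_der rb tofracM expr1.
  by exists s; apply: val_inj; rewrite rmorphM /= vtau vs.
- move=> a; have [m hm] := clear_poles ht (fun j => D j (tofrac a)).
  have /choice [b hb] := hm.
  have [|r [vr _]] := @twisted_mem (t ^+ m * a) b; last by exists m, r.
  by move=> j; rewrite tofracM tofracXn derMXt hb.
Qed.

End TwistedSplit.

(** * Ideals, stability and finite generation *)

Section IdealTheory.
Variable R : comNzRingType.
Implicit Types (I J : ideal R) (x y r : R).

Lemma ideal_of (P : R -> Prop) : P 0 ->
  (forall r x y, P x -> P y -> P (r * x + y)) ->
  exists I : ideal R, forall x : R, x \in I <-> P x.
Proof.
move=> P0 PD; pose S : {pred R^o} := fun x => `[< P x >].
have hS : GRing.submod_closed S.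
  by split=> [|r x y /asboolP Px /asboolP Py]; apply/asboolP => //; apply: PD.
pose I : ideal R := HB.pack S (GRing.isSubmodClosed.Build R R^o S hS).
by exists I => x; split=> /asboolP.
Qed.

Lemma ideal_mull I r x : x \in I -> r * x \in I.
Proof. exact: (@rpredZ _ _ I r x). Qed.

Lemma ideal_mulr I x r : x \in I -> x * r \in I.
Proof. by rewrite mulrC; apply: ideal_mull. Qed.

Lemma ideal_add I x y : x \in I -> y \in I -> x + y \in I.
Proof. exact: (@rpredD R^o I x y). Qed.

Lemma ideal_sub I x y : x \in I -> y \in I -> x - y \in I.
Proof. by move=> Ix Iy; rewrite -mulN1r; apply/ideal_add/ideal_mull. Qed.

Lemma ideal_zero I : (0 : R) \in I.
Proof. exact: (@rpred0 R^o I). Qed.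

Lemma ideal_sum I (K : Type) (s : seq K) (f : K -> R) :
  (forall k, f k \in I) -> \sum_(k <- s) f k \in I.
Proof. by move=> hf; elim/big_rec: _ => [|k x _]; [exact: ideal_zero|apply: ideal_add]. Qed.

Lemma prime_idealX I x m : prime_ideal I -> x ^+ m \in I -> x \in I.
Proof.
move=> [I1 Ip]; elim: m => [|m IHm]; first by rewrite expr0 (negPf I1).
by rewrite exprS => /Ip [].
Qed.

End IdealTheory.

(** Under these hypotheses evaluation at x identifies U with the free module of rank
    one over its endomorphism ring. *)
Lemma projective_endo_cyclic (R : comNzRingType) (U : lmodType R) (x : U) :
  (forall y, exists f : endo U, f x = y) ->
  (forall f : endo U, f x = 0 -> f = 0) ->
  @projective (endo U) (endo_module U).
Proof.
move=> xgen xfree A B g h gsurj.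
have [a ga] := gsurj (h x); have [f hf] := choice xgen.
have xinj (f1 f2 : endo U) : f1 x = f2 x -> f1 = f2.
  move=> e12; apply/eqP; rewrite -subr_eq0; apply/eqP/xfree.
  by apply/eqP; rewrite subr_eq0; apply/eqP.
pose k (y : endo_module U) : A := f y *: a.
have klin : linear k.
  move=> phi y z; rewrite /k scalerA -scalerDl; congr (_ *: _).
  by apply: xinj; rewrite hf; congr (_ + _); [rewrite -[in LHS](hf y)|rewrite hf].
pose K : {linear endo_module U -> A} :=
  HB.pack k (GRing.isLinear.Build (endo U) (endo_module U) A _ k klin).
exists K => y; transitivity (f y *: g a); first exact: linearZ_LR.
by rewrite ga -linearZ; congr (h _); apply: hf.
Qed.

(** When I^2 = x I, every y in I yields the endomorphism z |-> y z / x of I, and an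
    endomorphism is determined by its value at x. *)
Lemma stable_ideal_square (R : idomainType) (I : ideal R) (x : R) :
  x \in I -> x != 0 ->
  (forall y z, y \in I -> z \in I -> exists2 w, w \in I & y * z = x * w) ->
  stable_ideal I.
Proof.
move=> Ix x0 Isq; pose X : ideal_module I := Sub (x : R^o) Ix.
apply: (@projective_endo_cyclic _ (ideal_module I) X) => [y|f fX].
  have /choice [f hf] : forall z : ideal_module I, exists w : ideal_module I,
      (val y : R) * (val z : R) = x * (val w : R).
    move=> z; have [w Iw yz] := Isq (val y) (val z) (valP y) (valP z).
    by exists (Sub (w : R^o) Iw); rewrite SubK.
  have flin : linear f.
    have vD (q : R) (w w' : ideal_module I) :
      (val (q *: w + w') : R) = q * (val w : R) + (val w' : R) by [].
    move=> r u v; apply: val_inj; apply: (mulfI x0).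
    transitivity ((val y : R) * (val (r *: u + v) : R)); first exact/esym/hf.
    rewrite (vD r u v); transitivity (x * (r * (val (f u) : R) + (val (f v) : R))).
      by rewrite !mulrDr mulrCA [in RHS]mulrCA !hf.
    by rewrite -vD.
  pose E : endo (ideal_module I) :=
    HB.pack f (GRing.isLinear.Build R (ideal_module I) (ideal_module I) _ f flin).
  exists E; apply: val_inj; apply: (mulfI x0).
  by transitivity ((val y : R) * x); [exact/esym/(hf X)|rewrite mulrC].
apply: endo_ext => z; apply: val_inj; apply: (mulfI x0).
have : (x : R) *: f z = (val z : R) *: f X.
  rewrite -!linearZ; congr (f _); apply: val_inj; rewrite /= /GRing.scale /= mulrC //.
rewrite fX scaler0 => /(congr1 val) xfz.
by transitivity (0 : R); [exact: xfz|rewrite mulr0].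
Qed.

Section FiniteSpan.
Variables (R : comNzRingType) (I : ideal R).
Implicit Types (P Q : R -> Prop) (x y r : R).

(** For P strictly smaller than I, the generators need not satisfy P; this lets the
    conditions on y be dropped one at a time. *)
Definition finitely_spanned P : Prop :=
  exists (n : nat) (g : 'I_n -> R), (forall i, g i \in I) /\
    forall y, P y -> exists c : 'I_n -> R, y = \sum_i c i * g i.

Lemma finitely_spanned_step P Q x : x \in I ->
  (forall y, P y -> exists r, Q (y - r * x)) ->
  finitely_spanned Q -> finitely_spanned P.
Proof.
move=> Ix PQ [n [g [Ig gen]]].
exists n.+1, (fun i => oapp g x (unlift ord0 i)); split=> [i|y Py].
  by case: (unlift ord0 i) => [j|] /=.
have [r /gen [c yc]] := PQ y Py.
exists (fun i => oapp c r (unlift ord0 i)).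
rewrite big_ord_recl unlift_none /= (eq_bigr (fun i => c i * g i)) => [|i _].
  by rewrite -yc addrC subrK.
by rewrite liftK.
Qed.

Lemma finitely_spanned_generated : finitely_spanned (fun x => x \in I) ->
  exists n, ideal_generated_by n I.
Proof.
move=> [n [g [Ig gen]]]; exists n, g => x; split; first exact: gen.
by move=> [c ->]; apply: ideal_sum => i; apply: ideal_mull.
Qed.

End FiniteSpan.

Lemma generator_mem (R K : comNzRingType) (phi : {rmorphism R -> K}) (n : nat)
    (N : K -> Prop) (g : 'I_n -> K) :
  (forall x, N x <-> exists c : 'I_n -> R, x = \sum_i phi (c i) * g i) ->
  forall i, N (g i).
Proof.
move=> gen i; apply/gen; exists (fun j : 'I_n => (j == i)%:R).
rewrite (bigD1 i) //= eqxx rmorph1 mul1r big1 ?addr0 // => j /negPf ->.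
by rewrite rmorph0 mul0r.
Qed.

(** * Dimension and ideals of an analytically split subring *)

Section SplitDomain.
Variables (V R : idomainType) (t : V) (n : nat) (e : {rmorphism R -> V}).
Variables (d : 'I_n -> R -> V) (tau : R).
Hypothesis ht : uniformizer t.
Hypothesis hs : analytically_split t e d tau.
Implicit Types (r s : R) (j : 'I_n).

Lemma d_tauX j m : d j (tau ^+ m) = 0.
Proof.
elim: m => [|m IHm].
  have := split_dM hs j 1 1; rewrite mulr1 rmorph1 !mul1r => /eqP.
  by rewrite expr0 -subr_eq subrr eq_sym => /eqP.
by rewrite exprS (split_dM hs) IHm (split_dtau hs) !mulr0 addr0.
Qed.

Lemma e_tauX m : e (tau ^+ m) = t ^+ m.
Proof. by rewrite rmorphXn (split_tau hs). Qed.

Lemma d_tauXM j m r : d j (tau ^+ m * r) = t ^+ m * d j r.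
Proof. by rewrite (split_dM hs) d_tauX e_tauX mulr0 addr0. Qed.

Lemma dvd_tauX m r : tdvd t m (e r) -> (forall j, tdvd t m (d j r)) ->
  exists s, r = tau ^+ m * s.
Proof.
elim: m r => [|m IHm] r er dr; first by exists r; rewrite mul1r.
have t0 : t != 0 by case: ht.
have [s rs] : exists s, r = tau * s.
  by apply: (split_dvd hs) => [|j]; apply: tdvdW (_ : 1 <= m.+1)%N _.
have [||q sq] := IHm s; last by exists q; rewrite rs sq exprS mulrA.
  have [c ec] := er; exists c; apply: (mulfI t0).
  by rewrite mulrA -exprS -ec rs rmorphM (split_tau hs).
move=> j; have [c ec] := dr j; exists c; apply: (mulfI t0).
by rewrite mulrA -exprS -ec rs -[tau]expr1 d_tauXM expr1.
Qed.

Lemma split_unitP r : reflect (~ tdvd t 1 (e r)) (r \is a GRing.unit).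
Proof.
apply: (iffP idP) => [/(rmorph_unit e)/(tdvd1P ht)//|/(tdvd1P ht)].
exact: (split_unit hs).
Qed.

(** Write e r = t^k u.  The element t^(2k) / r of F is t^k / u, with derivatives
    - d_j r / u^2, so an s in R close to it satisfies r s = tau^(2k) (1 + tau p). *)
Lemma dvd_power_tau r : r != 0 -> exists s m, r * s = tau ^+ m.
Proof.
move=> r0; have er0 : e r != 0 by rewrite -(rmorph0 e) (inj_eq (split_inj hs)).
case: (ht) => t0 _ /(_ _ er0) [k [u [uU er]]].
(* One more than 2k, so that r s / tau^(2k) is congruent to 1 modulo tau. *)
have [s [es ds]] := split_approx hs (k + k).+1 (t ^+ k / u) (fun j => - d j r / u ^+ 2).
have uu : u * u^-1 = 1 by rewrite divrr.
have [||p hp] := @dvd_tauX (k + k).+1 (r * s - tau ^+ (k + k)).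
- rewrite rmorphB rmorphM e_tauX er.
  have -> : t ^+ k * u * e s - t ^+ (k + k) = t ^+ k * u * (e s - t ^+ k / u).
    by rewrite mulrBr [_ * (_ / _)]mulrACA uu mulr1 exprD.
  exact: tdvdMl.
- move=> j; rewrite (split_dB hs) d_tauX subr0 (split_dM hs) er.
  have -> : t ^+ k * u * d j s + e s * d j r =
     t ^+ k * u * (d j s - - d j r / u ^+ 2) + (e s - t ^+ k / u) * d j r.
    have -> : u ^- 2 = u^-1 * u^-1 by rewrite -exprVn expr2.
    transitivity (t ^+ k * u * d j s + e s * d j r +
        t ^+ k * d j r * (u * u^-1 - 1) * u^-1).
      by rewrite uu subrr mulr0 mul0r addr0.
    by move: (u^-1) => w; ring.
  by apply: tdvdD; [apply: tdvdMl|apply: tdvdMr].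
have qU : 1 + tau * p \is a GRing.unit.
  apply/split_unitP; rewrite rmorphD rmorph1 rmorphM (split_tau hs) => h.
  apply: (not_tdvdS_X ht (m := 0)); rewrite expr0.
  have := tdvdB h (tdvdMr (e p) (tdvdX t 1)).
  by rewrite expr1 addrK.
exists (s / (1 + tau * p)), (k + k)%N.
have -> : r * (s / (1 + tau * p)) =
    (r * s - tau ^+ (k + k) + tau ^+ (k + k)) / (1 + tau * p).
  by rewrite subrK mulrA.
rewrite hp.
have -> : tau ^+ (k + k).+1 * p + tau ^+ (k + k) = tau ^+ (k + k) * (1 + tau * p).
  by rewrite exprSr; ring.
by rewrite mulrK.
Qed.

Lemma ideal_power_tau (I : ideal R) x : x \in I -> x != 0 ->
  exists m, forall k, (m <= k)%N -> tau ^+ k \in I.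
Proof.
move=> Ix /dvd_power_tau [s [m xs]]; exists m => k mk.
by rewrite -(subnK mk) exprD -xs; apply/ideal_mull/ideal_mulr.
Qed.

Lemma exists_max_ideal : exists m : ideal R, forall x, x \in m <-> tdvd t 1 (e x).
Proof.
apply: ideal_of => [|r x y]; first by rewrite rmorph0; apply: tdvd0.
by rewrite rmorphD rmorphM => ex ey; apply: tdvdD => //; apply: tdvdMl.
Qed.

Lemma ideal_nunit (I : ideal R) x : (1 : R) \notin I -> x \in I -> tdvd t 1 (e x).
Proof.
move=> I1 Ix; apply: contrapT => /split_unitP xU.
by case/negP: I1; rewrite -(mulVr xU); apply: ideal_mull.
Qed.

Section MaxIdeal.
Variable m : ideal R.
Hypothesis hm : forall x, x \in m <-> tdvd t 1 (e x).

Lemma max_ideal1 : (1 : R) \notin m.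
Proof. by apply/negP => /hm; apply/split_unitP; rewrite unitr1. Qed.

Lemma split_maximal_ideal : maximal_ideal m.
Proof.
split=> [|J mJ J1 x]; first exact: max_ideal1.
by apply/idP/idP => [/(ideal_nunit J1)/hm//|/mJ].
Qed.

Lemma split_maximal_ideal_unique (m' : ideal R) : maximal_ideal m' -> m' =i m.
Proof.
move=> [m'1 /(_ m) hm'] x; rewrite hm' ?max_ideal1 // => y /(ideal_nunit m'1).
by move/hm.
Qed.

(** A nonzero prime contains tau.  If t divides e y, then tau divides y^2, since
    d (y^2) = 2 y d y. *)
Lemma max_ideal_sub_prime (P : ideal R) x : prime_ideal P -> x \in P -> x != 0 ->
  {subset m <= P}.
Proof.
move=> hP Px x0 y /hm [c ec].
have [k /(_ k (leqnn k)) /(prime_idealX hP) Ptau] := ideal_power_tau Px x0.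
have [||s ys] := @dvd_tauX 1 (y ^+ 2).
- by rewrite rmorphXn ec; exists (t * c * c); ring.
- by move=> j; rewrite expr2 (split_dM hs) ec; exists (c * d j y + c * d j y); ring.
by apply: (prime_idealX hP (m := 2)); rewrite ys expr1; apply: ideal_mulr.
Qed.

End MaxIdeal.

Lemma split_quasilocal : quasilocal R.
Proof.
have [m hm] := exists_max_ideal; exists m; first exact: split_maximal_ideal.
exact: split_maximal_ideal_unique.
Qed.

Lemma split_tau_neq0 : tau != 0.
Proof. by case: ht => t0 _ _; rewrite -(inj_eq (split_inj hs)) (split_tau hs) rmorph0. Qed.

Lemma split_krull_dim : has_krull_dim R 1.
Proof.
have [m hm] := exists_max_ideal; split.
  have [Z hZ] : exists Z : ideal R, forall x : R, x \in Z <-> x = 0.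
    by apply: ideal_of => // r x y -> ->; rewrite mulr0 addr0.
  exists (fun i => if i is 0%N then Z else m); split=> [[|i] _|[|//] _].
  - split=> [|x y]; first by apply/negP => /hZ/eqP; rewrite oner_eq0.
    by move/hZ/eqP; rewrite mulf_eq0 => /orP [] /eqP h; [left|right]; apply/hZ.
  - split=> [|x y mxy]; first exact: max_ideal1.
    have [/hm mx|/split_unitP xU] := pselect (tdvd t 1 (e x)); first by left.
    by right; rewrite -[y](mulKr xU); apply: ideal_mull.
  - split=> [x /hZ ->|]; first exact: ideal_zero.
    exists tau; last by apply/negP => /hZ/eqP; apply/negP; exact: split_tau_neq0.
    by apply/hm; rewrite (split_tau hs) -[t]expr1; apply: tdvdX.
move=> [P [Pp Ps]].
have [_ [x Px P0x]] := Ps 0%N isT; have [P12 [y P2y P1y]] := Ps 1%N isT.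
have x0 : x != 0 by apply: contraNneq P0x => ->; apply: ideal_zero.
have mP1 := max_ideal_sub_prime hm (Pp 1%N isT) Px x0.
by case/negP: P1y; apply/mP1/hm/(ideal_nunit _ P2y); case: (Pp 2%N isT).
Qed.

Lemma split_approx_e m a : exists r, tdvd t m (e r - a).
Proof. by have [r []] := split_approx hs m a (fun=> 0); exists r. Qed.

(** With x of least value in I and r, s in R close to z / x and y / x,
    y z = x (r y + s z - r s x) + (y - s x) (z - r x), and the last product is
    divisible by a high power of tau, because it and its derivatives are divisible
    by that power of t. *)
Lemma split_ideal_square (I : ideal R) : (exists2 x, x \in I & x != 0) ->
  exists x, [/\ x \in I, x != 0 &
    forall y z, y \in I -> z \in I -> exists2 w, w \in I & y * z = x * w].
Proof.
move=> [x1 Ix1 x10].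
have [|_ [[x [Ix <-]] xmin]] :=
    @exists_tdvd_min V t ht (fun a => exists x, x \in I /\ e x = a).
  by exists (e x1), x1.
have x0 : x != 0.
  apply: contra_neq x10 => x0; have [|c] := xmin (e x1); first by exists x1.
  by rewrite x0 rmorph0 mul0r => /eqP; rewrite -(rmorph0 e) (inj_eq (split_inj hs)) => /eqP.
exists x; split=> // y z Iy Iz.
have [J hJ] : exists J : ideal R, forall y : R, y \in J <-> exists2 w, w \in I & y = x * w.
  apply: ideal_of => [|r _ _ [u Iu ->] [v Iv ->]].
    by exists 0; rewrite ?mulr0 ?ideal_zero.
  by exists (r * u + v); [apply: ideal_add => //; apply: ideal_mull|ring].
have [m /(_ m (leqnn m)) Jtau] : exists m, forall k, (m <= k)%N -> tau ^+ k \in J.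
  apply: (ideal_power_tau (x := x * x)); last by rewrite mulf_neq0.
  by apply/hJ; exists x.
have [a ya] : exists a, e y = e x * a by apply: xmin; exists y.
have [b zb] : exists b, e z = e x * b by apply: xmin; exists z.
have [r er] := split_approx_e m b; have [s es] := split_approx_e m a.
have eys : tdvd t m (e (y - s * x)).
  rewrite rmorphB rmorphM ya; have -> : e x * a - e s * e x = - (e x * (e s - a)) by ring.
  exact/tdvdN/tdvdMl.
have ezr : tdvd t m (e (z - r * x)).
  rewrite rmorphB rmorphM zb; have -> : e x * b - e r * e x = - (e x * (e r - b)) by ring.
  exact/tdvdN/tdvdMl.
have [||q hq] := dvd_tauX (m := m) (r := (y - s * x) * (z - r * x)).
- by rewrite rmorphM; apply: tdvdMl.
- by move=> j; rewrite (split_dM hs); apply: tdvdD; apply: tdvdMr.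
have /hJ [w Iw hw] : (tau ^+ m * q : R) \in J by apply: ideal_mulr.
exists (w + (r * y + s * z - r * s * x)).
  by apply: ideal_add => //; apply: ideal_sub; first apply: ideal_add; apply: ideal_mull.
by rewrite mulrDr -hw -hq; ring.
Qed.

Lemma split_stable : stable_ring R.
Proof.
move=> I [x1 Ix1 x1reg]; have [|x [Ix x0 Isq]] := @split_ideal_square I.
  exists x1 => //; apply/eqP => x10.
  have /eqP : (1 : R) = 0 by apply: x1reg; rewrite x10 !mul0r.
  by rewrite oner_eq0.
exact: stable_ideal_square Isq.
Qed.

(** * Finite generation and embedding dimension *)

(** Let tau^m be in I.  Modulo t^m, each of the maps e, d_1, ..., d_n is linear over
    R, through the surjection of R onto V / t^m, on the part of I where the previous
    ones vanish.  Its image is generated by its element of least value.  When all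
    of them vanish, y is a multiple of tau^m. *)
Lemma split_noetherian : noetherian R.
Proof.
move=> I; have [[x [Ix x0]]|I0] := pselect (exists x, x \in I /\ x != 0); last first.
  exists 0%N, (fun=> 0) => x; split=> [Ix|[c ->]]; last first.
    by rewrite big_ord0; apply: ideal_zero.
  exists (fun=> 0); rewrite big_ord0; apply/eqP; apply: contra_notT I0 => x0.
  by exists x.
have [m /(_ m (leqnn m)) Itau] := ideal_power_tau Ix x0.
apply: finitely_spanned_generated.
(* The coordinates d_j with j in u are still to be cleared. *)
pose P (u : seq 'I_n) y := [/\ y \in I, tdvd t m (e y) &
  forall j, j \notin u -> tdvd t m (d j y)].
have fgP u : finitely_spanned I (P u).
  elim: u => [|j u IHu].
    exists 1%N, (fun=> tau ^+ m); split=> // y [_ ey dy].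
    have [|q yq] := dvd_tauX ey; first by move=> j; apply: dy.
    by exists (fun=> q); rewrite big_ord1 mulrC.
  have [|_ [[z [Iz ez dz] <-] zmin]] :=
      @exists_tdvd_min V t ht (fun a => exists2 y, P (j :: u) y & d j y = a).
    exists (d j (tau ^+ m)), (tau ^+ m) => //; split=> // [|k _].
      by rewrite e_tauX; apply: tdvdX.
    by rewrite d_tauX; apply: tdvd0.
  apply: (finitely_spanned_step Iz _ IHu) => y [Iy ey dy].
  have [c yc] : exists c, d j y = d j z * c by apply: zmin; exists y.
  have [r rc] := split_approx_e m c.
  exists r; split=> [||k ku]; first by apply: ideal_sub => //; apply: ideal_mull.
    by rewrite rmorphB rmorphM; apply: tdvdB => //; apply: tdvdMl.
  rewrite (split_dB hs) (split_dM hs) opprD addrA.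
  apply: tdvdB; last exact: tdvdMr.
  have [->|kj] := eqVneq k j.
    have -> : d j y - e r * d j z = - (d j z * (e r - c)) by rewrite yc; ring.
    exact/tdvdN/tdvdMl.
  have kju : k \notin j :: u by rewrite inE negb_or kj.
  by apply: tdvdB; [apply: dy|apply: tdvdMl; apply: dz].
have [|_ [[z [Iz _] <-] zmin]] :=
  @exists_tdvd_min V t ht (fun a => exists2 y, y \in I /\ True & e y = a).
  by exists (e x), x.
apply: (finitely_spanned_step Iz _ (fgP (enum 'I_n))) => y Iy.
have [c yc] : exists c, e y = e z * c by apply: zmin; exists y.
have [r rc] := split_approx_e m c.
exists r; split=> [||k]; last by rewrite mem_enum.
  by apply: ideal_sub => //; apply: ideal_mull.
have -> : e (y - r * z) = - (e z * (e r - c)) by rewrite rmorphB rmorphM yc; ring.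
exact/tdvdN/tdvdMl.
Qed.

Lemma d_sum j (K : Type) (u : seq K) (f : K -> R) :
  d j (\sum_(i <- u) f i) = \sum_(i <- u) d j (f i).
Proof.
have d0 : d j 0 = 0 by rewrite -(subrr 0) (split_dB hs) !subrr.
have dD x y : d j (x + y) = d j x + d j y.
  by rewrite -{1}[y]opprK -[- y]sub0r !(split_dB hs) d0 sub0r opprK.
by elim: u => [|i u IHu]; rewrite ?big_nil // !big_cons dD IHu.
Qed.

(** Divisibility of y by t^2, not only by t, makes the coordinate e y / t vanish
    modulo t. *)
Lemma split_dual_generators : exists y : 'I_n -> R,
  (forall i, tdvd t 2 (e (y i))) /\
  forall i j, tdvd t 1 (d j (y i) - (i == j)%:R).
Proof.
have /choice [y hy] : forall i, exists y, tdvd t 2 (e y) /\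
    forall j, tdvd t 1 (d j y - (i == j)%:R).
  move=> i; have [y [ey dy]] := split_approx hs 2 0 (fun j => (i == j)%:R).
  exists y; split=> [|j]; first by rewrite subr0 in ey.
  exact: tdvdW (dy j).
by exists y; split=> [i|i j]; have [] := hy i.
Qed.

Definition max_ideal_generators (y : 'I_n -> R) (i : 'I_n.+1) : R :=
  oapp y tau (unlift ord0 i).

Lemma max_ideal_generated (m : ideal R) (y : 'I_n -> R) :
  (forall x, x \in m <-> tdvd t 1 (e x)) ->
  (forall i, tdvd t 2 (e (y i))) ->
  (forall i j, tdvd t 1 (d j (y i) - (i == j)%:R)) ->
  generated_by (idfun : {rmorphism R -> R}) n.+1 (fun x => x \in m).
Proof.
move=> hm ey dy; have ey1 i : tdvd t 1 (e (y i)) by apply: tdvdW (ey i).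
exists (max_ideal_generators y) => x; split; last first.
  move=> [c ->]; apply: ideal_sum => i; apply: ideal_mull; apply/hm.
  rewrite /max_ideal_generators; case: (unlift ord0 i) => [j|] /=; first exact: ey1.
  by rewrite (split_tau hs) -[t]expr1; apply: tdvdX.
move=> /hm ex; have /choice [r hr] := fun j => split_approx_e 1 (d j x).
have [||q hq] := dvd_tauX (m := 1) (r := x - \sum_j r j * y j).
- rewrite rmorphB rmorph_sum; apply: tdvdB => //; apply: tdvd_sum => j _.
  by rewrite rmorphM; apply: tdvdMl.
- move=> k; rewrite (split_dB hs) d_sum.
  have -> : d k x - \sum_j d k (r j * y j) = - (e (r k) - d k x) -
      \sum_j (e (r j) * (d k (y j) - (j == k)%:R) + e (y j) * d k (r j)).
    have -> : e (r k) = \sum_j e (r j) * (j == k)%:R.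
      rewrite (bigD1 k) //= eqxx mulr1 big1 ?addr0 // => j /negPf ->.
      by rewrite mulr0.
    rewrite opprB -addrA -opprD -big_split /=; congr (_ - _); apply: eq_bigr => j _.
    by rewrite (split_dM hs); ring.
  apply: tdvdB; first exact: tdvdN.
  by apply: tdvd_sum => j _; apply: tdvdD; [apply: tdvdMl|apply: tdvdMr].
exists (fun i => oapp r q (unlift ord0 i)).
rewrite big_ord_recl /max_ideal_generators unlift_none /=.
under eq_bigr do rewrite liftK /=.
by rewrite mulrC -[tau]expr1 -hq subrK.
Qed.

(** The map y |-> (e y / t, d_1 y, ..., d_n y) modulo t from the maximal ideal to
    k^(n+1) is semilinear along R -> k and sends tau and the y_i to the standard
    basis.  Writing these in terms of N generators factors the identity matrix of
    size n + 1 through k^N. *)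
Lemma max_ideal_rank (k : fieldType) (pi : {rmorphism V -> k}) (m : ideal R)
    (y : 'I_n -> R) (N : nat) : pi t = 0 ->
  (forall x, x \in m <-> tdvd t 1 (e x)) ->
  (forall i, tdvd t 2 (e (y i))) ->
  (forall i j, tdvd t 1 (d j (y i) - (i == j)%:R)) ->
  ideal_generated_by N m -> (n.+1 <= N)%N.
Proof.
move=> pit hm ey dy [g gen].
have pi0 a : tdvd t 1 a -> pi a = 0.
  by case=> c ->; rewrite rmorphM expr1 pit mul0r.
have mg := generator_mem gen.
have /choice [a ha] : forall i, exists a, e (g i) = t * a.
  by move=> i; have /hm [a ga] := mg i; exists a; rewrite ga expr1.
have mgen l : max_ideal_generators y l \in m.
  apply/hm; rewrite /max_ideal_generators; case: (unlift ord0 l) => [j|] /=.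
    exact: tdvdW (ey j).
  by rewrite (split_tau hs) -[t]expr1; apply: tdvdX.
have /choice [c hc] := fun l => (gen _).1 (mgen l).
pose G := \matrix_(i < N, l < n.+1)
  if unlift ord0 l is Some j then pi (d j (g i)) else pi (a i).
pose C := \matrix_(l < n.+1, i < N) pi (e (c l i)).
apply: (@mulmx1_min _ _ _ C G); apply/matrixP => l l'; rewrite !mxE.
have t0 : t != 0 by case: ht.
case: (unliftP ord0 l') => [j|] l'E; rewrite l'E.
  transitivity (pi (d j (max_ideal_generators y l))).
    rewrite hc d_sum rmorph_sum; apply: eq_bigr => i _.
    rewrite !mxE liftK (split_dM hs) rmorphD !rmorphM /=.
    by rewrite [pi (e (g i))]pi0 ?mul0r ?addr0 //; apply/hm.
  rewrite /max_ideal_generators; case: (unliftP ord0 l) => [i|] -> /=.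
    rewrite (inj_eq lift_inj); have /pi0 := dy i j.
    rewrite rmorphB => /eqP; rewrite subr_eq0 => /eqP ->.
    by rewrite rmorph_nat.
  by rewrite (split_dtau hs) rmorph0.
have -> : \sum_i C l i * G i ord0 = pi (\sum_i e (c l i) * a i).
  by rewrite rmorph_sum; apply: eq_bigr => i _; rewrite !mxE unlift_none rmorphM.
have ta : t * (\sum_i e (c l i) * a i) = e (max_ideal_generators y l).
  rewrite hc rmorph_sum mulr_sumr; apply: eq_bigr => i _.
  by rewrite /= rmorphM ha; ring.
move: ta; rewrite /max_ideal_generators; case: (unliftP ord0 l) => [i|] -> /= ta.
  rewrite pi0 /= ?[lift _ _ == _]eq_sym ?(negPf (neq_lift _ _)) //.
  have [b eb] := ey i; exists b; apply: (mulfI t0).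
  by rewrite ta eb expr1 expr2 mulrA.
move: ta; rewrite (split_tau hs) -{2}[t]mulr1 => /(mulfI t0) ->.
by rewrite rmorph1.
Qed.

Lemma split_embedding_dim : equichar0 V -> has_embedding_dim R n.+1.
Proof.
move=> [_ [k [pi [[pisurj _] _]]]].
have pit : pi t = 0.
  apply/eqP; apply: contraT => pit0; have [x px] := pisurj (pi t)^-1.
  have : pi (1 - t * x) \is a GRing.unit.
    apply/rmorph_unit/(tdvd1P ht) => h; apply: (not_tdvdS_X ht (m := 0)).
    by rewrite expr0 -(subrK (t * x) 1); apply: tdvdD => //; exists x; rewrite expr1.
  by rewrite rmorphB rmorph1 rmorphM px divff // subrr unitr0.
have [m hm] := exists_max_ideal; have [y [ey dy]] := split_dual_generators.
exists m; first exact: (split_maximal_ideal hm).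
split; first exact: max_ideal_generated hm ey dy.
by move=> N; apply: max_ideal_rank pit hm ey dy.
Qed.

(** * Normalization *)

(** For m such that t^m v is in R, and r in R close to v, g = t^m (v - r) is in R and
    divisible by t^(2m) in V.  Hence g^2 and its derivatives 2 g d g are divisible
    by t^(2m), so that g^2 / t^(2m) is in R. *)
Lemma split_quadratic (v : V) : exists r s, (v - e r) ^+ 2 = e s.
Proof.
have [m [r' vr']] := split_conductor hs v.
have [r vr] := split_approx_e m v.
pose g := r' - tau ^+ m * r.
have eg : e g = t ^+ m * (v - e r).
  by rewrite rmorphB vr' rmorphM e_tauX mulrBr.
have teg : tdvd t (m + m) (e g).
  rewrite eg; apply: tdvdM; first exact: tdvdX.
  by rewrite -opprB; apply: tdvdN.
have [||s gs] := dvd_tauX (m := (m + m)%N) (r := g ^+ 2).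
- by rewrite rmorphXn expr2; apply: tdvdMl.
- by move=> j; rewrite expr2 (split_dM hs); apply: tdvdD; apply: tdvdMr.
exists r, s; have tm0 := tX_neq0 ht (m + m); apply: (mulfI tm0).
by rewrite -e_tauX -[RHS]rmorphM -gs [RHS]rmorphXn /= eg e_tauX exprD; ring.
Qed.

(** V lies in R[1/tau], which gives its embedding in the fraction field of R.  It is
    integral over R by [split_quadratic], and it is integrally closed. *)
Lemma split_normalization_map : exists iota : {rmorphism V -> {fraction R}},
  [/\ injective iota, forall r, iota (e r) = tofrac r &
      forall x : {fraction R}, in_normalization x <-> exists v, iota v = x].
Proof.
have [psi psiE] : exists g : {rmorphism {fraction R} -> {fraction V}},
    forall r, g (tofrac r) = tofrac (e r).
  apply: (@fraction_lift R _ ((@tofrac V) \o e)) => r s /=.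
  by move/(@tofrac_inj V)/(split_inj hs).
have psi_inj := fmorph_inj psi.
have /choice [iota iotaE] : forall v : V, exists x, psi x = tofrac v.
  move=> v; have [m [r vr]] := split_conductor hs v.
  exists (tofrac r / tofrac (tau ^+ m)); rewrite fmorph_div !psiE vr e_tauX.
  have tm0 : tofrac (t ^+ m) != 0 by rewrite tofrac_eq0 tX_neq0.
  by rewrite tofracM mulrAC divff // mul1r.
have iB : zmod_morphism iota.
  by move=> a b; apply: psi_inj; rewrite rmorphB !iotaE tofracB.
have iM : monoid_morphism iota.
  split=> [|a b]; apply: psi_inj; first by rewrite iotaE !rmorph1.
  by rewrite rmorphM !iotaE tofracM.
pose I : {rmorphism V -> {fraction R}} := HB.pack iota
  (GRing.isZmodMorphism.Build _ _ iota iB) (GRing.isMonoidMorphism.Build _ _ iota iM).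
have iotae r : iota (e r) = tofrac r by apply: psi_inj; rewrite iotaE psiE.
exists I; split=> [a b /= ab|//|x]; first by apply: tofrac_inj; rewrite -!iotaE ab.
split=> [[p pm px]|[v <-]].
  have [v xv] : integral_frac (psi x).
    apply: (uniformizer_integrally_closed (p := map_poly e p) ht).
      exact: monic_map.
    have -> : map_poly (@tofrac V) (map_poly e p) = map_poly psi (map_poly (@tofrac R) p).
      by apply/polyP => i; rewrite !coef_map /= psiE.
    exact: rmorph_root.
  by exists v; apply: psi_inj; rewrite /= iotaE.
have [r [s vrs]] := split_quadratic v.
(* Monic, with root v because (v - r)^2 = s. *)
exists (('X - r%:P) ^+ 2 - s%:P).
  rewrite monicE lead_coefDl; first by rewrite -monicE monic_exp // monicXsubC.
  by rewrite size_polyN size_exp_XsubC ltnS (leq_trans (size_polyC_leq1 _)).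
apply/rootP; rewrite rmorphB rmorphXn rmorphB /= map_polyX !map_polyC /=.
have horner_quad (K : comNzRingType) (a b y : K) :
    (('X - a%:P) ^+ 2 - b%:P).[y] = (y - a) ^+ 2 - b by rewrite !hornerE.
rewrite horner_quad; apply/eqP; rewrite subr_eq0; apply/eqP/psi_inj.
by rewrite rmorphXn rmorphB /= iotaE !psiE -tofracB -tofracXn vrs.
Qed.

Lemma split_is_normalization : is_normalization V R.
Proof. by have [iota [inj _ h]] := split_normalization_map; exists iota. Qed.

(** A common denominator t^m of finitely many generators would be one for all of V.
    But some r in R has e r divisible by t^(m+1) and d_j r congruent to 1; if
    e r / t were in R, then t would divide d_j r. *)
Lemma split_not_finite (j : 'I_n) :
  ~ exists N, generated_by (@tofrac R) N (@in_normalization R).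
Proof.
have [iota [iinj iE inorm]] := split_normalization_map.
move=> [N [g gen]].
have /choice [v gv] := fun i => (inorm _).1 (generator_mem gen i).
have /choice [k /choice [r vr]] := fun i => split_conductor hs (v i).
pose m := \max_i k i.
have all_v a : exists q, e q = t ^+ m * a.
  have [c ac] := (gen _).1 ((inorm _).2 (ex_intro _ a erefl)).
  have -> : a = \sum_i e (c i) * v i.
    apply: iinj; rewrite ac rmorph_sum; apply: eq_bigr => i _.
    by rewrite rmorphM iE gv.
  exists (\sum_i tau ^+ (m - k i) * c i * r i).
  rewrite rmorph_sum mulr_sumr; apply: eq_bigr => i _.
  rewrite !rmorphM e_tauX vr -{2}(subnK (leq_bigmax i : k i <= m)%N) exprD.
  by ring.
have [x [[a ea] dx]] := split_approx hs m.+1 0 (fun=> 1).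
have [q eq] := all_v a.
have xq : x = tau * q.
  apply: (split_inj hs); rewrite rmorphM (split_tau hs) eq mulrA -exprS -ea.
  by rewrite subr0.
apply: (not_tdvdS_X ht (m := 0)); rewrite expr0.
have := tdvdW (ltn0Sn m) (dx j); rewrite xq -[tau]expr1 d_tauXM => h.
have -> : 1 = t ^+ 1 * d j q - (t ^+ 1 * d j q - 1) by ring.
by apply: tdvdB => //; apply: tdvdMr; apply: tdvdX.
Qed.

Lemma split_bad_noetherian_stable : (0 < n)%N -> bad_noetherian_stable_domain R.
Proof.
move=> n0; split; last exact: split_noetherian.
split.
- exact: split_krull_dim.
- exact: split_quasilocal.
- exact: split_stable.
- exact: (split_not_finite (Ordinal n0)).
Qed.

End SplitDomain.

(** * Existence of the derivations *)

Lemma fraction_pchar0 (V : idomainType) :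
  [pchar V] =i pred0 -> [pchar {fraction V}] =i pred0.
Proof.
move=> V0 p; rewrite -(V0 p) !inE; congr (_ && _).
by rewrite -[in RHS]tofrac_eq0 rmorph_nat.
Qed.

(** An integer polynomial vanishing at x vanishes as a rational polynomial. *)
Lemma fraction_int_independent (V : idomainType) (n : nat) (x : 'I_n -> V) :
  alg_independent x -> int_independent (fun i => tofrac (x i)).
Proof.
move=> hx p hp; pose q : {mpoly rat[n]} := map_mpoly intr p.
have mq : mmap intr x p = 0.
  apply/eqP; rewrite -tofrac_eq0 -[X in _ == X]hp; apply/eqP.
  rewrite /mmap rmorph_sum; apply: eq_bigr => m _.
  rewrite rmorphM rmorph_int; congr (_ * _).
  by rewrite /mmap1 rmorph_prod; apply: eq_bigr => i _; rewrite rmorphXn.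
have qp m : q@_m = (p@_m)%:~R by rewrite mcoeff_map_mpoly.
have q0 : q = 0.
  apply: hx; rewrite -[RHS]mq /mmap (perm_big (msupp p)) /=.
    by apply: eq_bigr => m _; rewrite qp ratr_int.
  apply: uniq_perm => [||m]; rewrite ?msupp_uniq // !mcoeff_msupp qp.
  by rewrite intr_eq0.
apply/mpolyP => m; rewrite mcoeff0; apply/eqP.
have := congr1 (mcoeff m) q0; rewrite qp mcoeff0 => /eqP.
by rewrite intr_eq0.
Qed.

(** Splitting the sequence of [free_sequence] into residue classes modulo n gives each
    D_j its own subsequence; the N-th term gets the value t^-N. *)
Lemma free_derivations (V : idomainType) (t : V) (n : nat) :
  [pchar V] =i pred0 -> infinite_trdeg V -> uniformizer t ->
  exists D : derivations {fraction V} n,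
    (forall j, D j (tofrac t) = 0) /\
    forall j m, exists k (u : V), (m <= k)%N /\
      forall i, D i (tofrac u) = (i == j)%:R / tofrac t ^+ k.
Proof.
move=> V0 htr ht.
have ind m : exists z : 'I_m -> {fraction V},
    (forall i, integral_frac (z i)) /\ int_independent z.
  have [x hx] := htr m; exists (fun i => tofrac (x i)).
  by split=> [i|]; [exists (x i)|apply: fraction_int_independent].
have [x [xV hx]] := free_sequence (fraction_pchar0 V0) ind (tofrac t).
have /choice [D hD] := fun j : 'I_n =>
  hx (fun N => if (N %% n == j)%N then (tofrac t ^+ N)^-1 else 0).
have dD j : derivation (D j) by case: (hD j).
exists (Derivations dD); split=> [j|j m]; first by case: (hD j).
have [u xu] := xV (m * n + j)%N; exists (m * n + j)%N, u.
have n0 : (0 < n)%N by apply: leq_ltn_trans (ltn_ord j).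
split=> [|i]; first by apply: leq_trans (leq_addr _ _); rewrite leq_pmulr.
rewrite /= -xu; have [_ _ ->] := hD i.
rewrite modnMDl modn_small // eq_sym.
have [->|ij] := eqVneq i j; first by rewrite eqxx mul1r.
by rewrite (negPf ij : (val i == val j) = false) mul0r.
Qed.

Local Close Scope ring_scope.

Theorem corollary7p2 (V : idomainType) (hV : is_DVR V) (hchar : equichar0 V)
    (htr : infinite_trdeg V) (d : nat) (hd : 1 < d) :
  exists R : idomainType,
    [/\ bad_noetherian_stable_domain R,
        is_normalization V R &
        has_embedding_dim R d].
Proof.
case: d hd => [|[|n]] // _.
have [t ht] := DVR_uniformizer hV.
have [D [Dt Dpole]] := free_derivations n.+1 hchar.1 htr ht.
have [dR [tau hs]] := twisted_split ht Dt Dpole.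
exists (twisted D); split.
- exact: split_bad_noetherian_stable ht hs _.
- exact: split_is_normalization ht hs.
- exact: split_embedding_dim ht hs hchar.
Qed.
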